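(* (a) $\mathcal{U}_R(\mathbb{D})\cap\mathcal{B}=\emptyset$. (b) There exists a set $E\subset\mathbb{T}$ with $m(E)=0$ such that $\mathcal{U}_R^{\mathbb{T}\setminus E}(\mathbb{D})\cap\mathcal{B}\neq\emptyset$.
   Context: $\mathbb{D}$ is the open unit disc, $\mathbb{T}$ the unit circle, $m$ arclength measure on $\mathbb{T}$. For $f\in H(\mathbb{D})$ and $\zeta\in\mathbb{T}$, the radial cluster set $C_{r_\zeta}(f)$ is the set of $w\in\mathbb{C}\cup\{\infty\}$ such that $w=\lim_n f(s_n\zeta)$ for some sequence $(s_n)$ in $[0,1)$ with $s_n\to1$; it is maximal if it equals $\mathbb{C}\cup\{\infty\}$. $\mathcal{U}_R(\mathbb{D})$ is the set of $f\in H(\mathbb{D})$ with $C_{r_\zeta}(f)$ maximal for all $\zeta\in\mathbb{T}$; for $K\subset\mathbb{T}$, $\mathcal{U}_R^K(\mathbb{D})$ is the set of $f\in H(\mathbb{D})$ with $C_{r_\zeta}(f)$ maximal for all $\zeta\in K$. $\mathcal{B}$ is the Bloch space of $f\in H(\mathbb{D})$ with $\sup_{z\in\mathbb{D}}(1-|z|^2)|f'(z)|<\infty$. *)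

(* Defs.v *)
From Stdlib Require Import Reals.
From Coquelicot Require Import Coquelicot.
Open Scope R_scope.

Definition in_disc (z : C) : Prop := Cmod z < 1.
Definition on_circle (z : C) : Prop := Cmod z = 1.

(* H(D): f is complex-differentiable at every point of the unit disc
   (values of f outside the disc are irrelevant). *)
Definition holomorphic_on_disc (f : C -> C) : Prop :=
  forall z : C, in_disc z -> ex_derive (K := C_AbsRing) (V := C_NormedModule) f z.

Inductive ext_C : Type :=
  | Fin : C -> ext_C
  | Infty : ext_C.

Definition radial_cluster_set (f : C -> C) (zeta : C) : ext_C -> Prop :=
  fun w => exists s : nat -> R,
    (forall n, 0 <= s n < 1) /\ is_lim_seq s 1 /\
    match w with
    | Fin a => filterlim (fun n => f (RtoC (s n) * zeta)%C) eventually (locally a)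
    | Infty => is_lim_seq (fun n => Cmod (f (RtoC (s n) * zeta)%C)) p_infty
    end.

Definition maximal_radial_cluster (f : C -> C) (zeta : C) : Prop :=
  forall w : ext_C, radial_cluster_set f zeta w.

Definition U_R_K (K : C -> Prop) (f : C -> C) : Prop :=
  holomorphic_on_disc f /\
  forall zeta, on_circle zeta -> K zeta -> maximal_radial_cluster f zeta.

Definition U_R (f : C -> C) : Prop := U_R_K on_circle f.

Definition bloch (f : C -> C) : Prop :=
  holomorphic_on_disc f /\
  exists M : R, forall z : C, in_disc z ->
    (1 - Cmod z ^ 2) * Cmod (C_derive f z) <= M.

(* E ⊆ T has arclength measure zero: E = {e^{it}} with the parameter set
   {t ∈ [0,2π) | e^{it} ∈ E} Lebesgue-null, i.e. for every eps > 0 it is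
   covered by countably many open intervals of total length <= eps. *)
Definition arc_null (E : C -> Prop) : Prop :=
  forall eps : R, 0 < eps ->
    exists a b : nat -> R,
      (forall n, a n <= b n) /\
      (forall t : R, 0 <= t < 2 * PI -> E (cos t, sin t) ->
         exists n, a n < t < b n) /\
      (forall N, sum_f_R0 (fun n => b n - a n) N <= eps).

(* Main.v *)
(** (a) Let [u] be the real part of a primitive of a Bloch function [f]. The function
    [u + |z|^2] has no interior maximum and is bounded above; let [p] on the circle be an
    accumulation point of a maximising sequence. The Bloch condition gives
    [u (r z) - u (rho z) <= (r - rho) (Re (z f (rho z)) + M)] for unimodular [z], so near-maximality
    forces [Re (p f (rho p)) >= - (M + 2)] for all [rho]: on this radius [f] stays in a half plane.

    (b) Take [f z = sum_j (j+1)^(-1/2) z^(n_j)] with [n_(j+1) = 4 (j+1)^2 n_j]. On suitable radii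
    [f] is close to its partial sums, and along the nested subdivision of the circle into [n_j]
    arcs these form a planar random walk with nearly independent isotropic steps of square
    length [1/(j+1)]. As [ln |s - w|^2 - lam |s - w|^2] is a supermartingale up to summable
    errors and [sum_j 1/(j+1)] diverges, almost every path enters every disc infinitely often. *)
Require Import Defs.
From Stdlib Require Import Reals Lra Lia Psatz Classical IndefiniteDescription List Cantor.
From Coquelicot Require Import Coquelicot.
Open Scope R_scope.

(** Part (a) works with real integrals only: [u] is the real part of a line integral, and Goursat's
    lemma for triangles makes its increments independent of the base point. In part (b) the
    coefficients must be bounded (Bloch condition), with divergent sum of squares (recurrence) and
    summable fourth powers (the error in the harmonicity of [ln |s|] under a four-point average);
    [(j+1)^(-1/2)] does all three. In the ratio [4 (j+1)^2], the factor 4 groups the subarcs into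
    quadruples on which the direction of the new term is exactly [om, i om, -om, -i om], and
    [(j+1)^2] makes the oscillation of the earlier terms over an arc [O(1/j^2)], hence summable, and
    the tail negligible on the good radii. No measure is constructed: a bound on the probability of
    avoiding a disc is rendered as a bound on the total length of a finite cover by intervals, and
    the supermartingale inequality becomes the step of a backward induction over the subdivision. *)

(** * Epsilon-delta differentiability, and compactness in the plane *)

Definition has_derivative (f : C -> C) (z l : C) : Prop :=
  forall eta, 0 < eta -> exists delta, 0 < delta /\
    forall h, Cmod h < delta ->
      Cmod (f (z + h) - f z - h * l)%C <= eta * Cmod h.

Lemma has_derivative_of_is_derive (f : C -> C) (z l : C) :
  is_derive (K := C_AbsRing) (V := C_NormedModule) f z l -> has_derivative f z l.
Proof.
  intros [_ H] eta Heta.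
  specialize (H z (fun P HP => HP) (mkposreal eta Heta)).
  destruct H as [d Hd].
  exists d; split; [apply cond_pos|].
  intros h Hh.
  assert (Hb : @ball (AbsRing_UniformSpace C_AbsRing) z d (z + h)%C).
  { unfold ball; simpl; unfold AbsRing_ball, abs; simpl.
    unfold minus, plus, opp; simpl.
    replace (z + h + - z)%C with h by ring. exact Hh. }
  specialize (Hd _ Hb).
  change (Cmod (f (z + h) + - f z + - ((z + h + - z) * l))%C
          <= eta * Cmod (z + h + - z)%C) in Hd.
  replace (z + h + - z)%C with h in Hd by ring.
  exact Hd.
Qed.

Lemma is_derive_of_has_derivative (f : C -> C) (z l : C) :
  has_derivative f z l -> is_derive (K := C_AbsRing) (V := C_NormedModule) f z l.
Proof.
  intros H. split.
  - apply is_linear_scal_l.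
  - intros x Hx.
    (* [is_derive] quantifies over every limit of the neighbourhood filter of [z]; by uniqueness of
       limits only [z] itself has to be treated. *)
    assert (Hxz : z = x).
    { apply (is_filter_lim_locally_unique (V := AbsRing_NormedModule C_AbsRing)). exact Hx. }
    subst x. intros eps.
    destruct (H eps (cond_pos eps)) as [d [Hd Hf]].
    exists (mkposreal d Hd). intros y Hy.
    unfold ball in Hy; simpl in Hy; unfold AbsRing_ball, abs in Hy; simpl in Hy.
    change (Cmod (y - z)%C < d) in Hy.
    specialize (Hf _ Hy).
    assert (E : forall u v : C, (u + (v - u))%C = v) by (intros; ring).
    rewrite (E z y) in Hf.
    change (Cmod (f y + - f z + - ((y + - z) * l))%C <= eps * Cmod (y + - z)%C).
    exact Hf.
Qed.

Definition continuous_on_disc (f : C -> C) : Prop :=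
  forall z, in_disc z -> forall eta, 0 < eta -> exists delta, 0 < delta /\
    forall h, Cmod h < delta -> Cmod (f (z + h) - f z)%C < eta.

Lemma holomorphic_has_derivative (f : C -> C) :
  holomorphic_on_disc f ->
  forall z, in_disc z -> has_derivative f z (C_derive f z).
Proof.
  intros Hf z Hz. destruct (Hf z Hz) as [l Hl].
  rewrite (is_C_derive_unique f z l Hl).
  now apply has_derivative_of_is_derive.
Qed.

Lemma holomorphic_continuous (f : C -> C) :
  holomorphic_on_disc f -> continuous_on_disc f.
Proof.
  intros Hf z Hz eta Heta.
  destruct (holomorphic_has_derivative f Hf z Hz 1 ltac:(lra)) as [d [Hd H]].
  set (l := C_derive f z) in *.
  assert (Hl := Cmod_ge_0 l).
  exists (Rmin d (eta / (2 + Cmod l))). split.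
  - apply Rmin_pos; [easy|]. apply Rdiv_lt_0_compat; lra.
  - intros h Hh.
    assert (H1 := Rlt_le_trans _ _ _ Hh (Rmin_l _ _)).
    assert (H2 := Rlt_le_trans _ _ _ Hh (Rmin_r _ _)).
    specialize (H h H1).
    replace (f (z + h) - f z)%C with ((f (z + h) - f z - h * l) + h * l)%C by ring.
    eapply Rle_lt_trans; [apply Cmod_triangle|].
    rewrite Cmod_mult.
    apply (Rmult_lt_compat_r (2 + Cmod l)) in H2; [|lra].
    unfold Rdiv in H2. rewrite Rmult_assoc, Rinv_l, Rmult_1_r in H2 by lra.
    assert (Hh0 := Cmod_ge_0 h). nra.
Qed.

Lemma bounded_seq_cluster_point (x : nat -> R) (m M : R) :
  (forall n, m <= x n <= M) -> exists l, m <= l <= M /\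
  forall eps N, 0 < eps -> exists n, (N <= n)%nat /\ Rabs (x n - l) < eps.
Proof.
  intros H.
  destruct (Bolzano_Weierstrass x (fun c => m <= c <= M) (compact_P3 m M) H) as [l Hl].
  assert (Hacc : forall eps N, 0 < eps -> exists n, (N <= n)%nat /\ Rabs (x n - l) < eps).
  { intros eps N He.
    destruct (Hl (disc l (mkposreal eps He)) N) as [n [Hn Hd]].
    - exists (mkposreal eps He). now intros y Hy.
    - now exists n. }
  exists l. split; [|exact Hacc].
  split; apply Rnot_lt_le; intros Hlt.
  - destruct (Hacc (m - l) 0%nat ltac:(lra)) as [n [_ Hn]].
    specialize (H n). apply Rabs_def2 in Hn. lra.
  - destruct (Hacc (l - M) 0%nat ltac:(lra)) as [n [_ Hn]].
    specialize (H n). apply Rabs_def2 in Hn. lra.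
Qed.

Lemma Cmod_le_abs_sum (z : C) : Cmod z <= Rabs (fst z) + Rabs (snd z).
Proof.
  destruct z as [x y]; simpl.
  replace (x, y) with ((RtoC x) + (0, y))%C by (unfold Cplus, RtoC; simpl; f_equal; ring).
  eapply Rle_trans; [apply Cmod_triangle|].
  rewrite Cmod_R. apply Rplus_le_compat_l.
  replace (0, y) with (Ci * y)%C by (unfold Cmult, Ci, RtoC; simpl; f_equal; ring).
  rewrite Cmod_mult, Cmod_Ci, Cmod_R. lra.
Qed.

Lemma im_le_Cmod (z : C) : Rabs (snd z) <= Cmod z.
Proof. eapply Rle_trans; [|apply Rmax_Cmod]. apply Rmax_r. Qed.

(** The indices [phi] make the real parts converge to [x]; the cluster point [y] of the imaginary
    parts is then taken along [phi], so that one index serves both coordinates. *)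
Lemma bounded_Cseq_cluster_point (z : nat -> C) (rho : R) :
  (forall n, Cmod (z n) <= rho) -> exists p, Cmod p <= rho /\
  forall eps N, 0 < eps -> exists n, (N <= n)%nat /\ Cmod (z n - p)%C < eps.
Proof.
  intros H.
  destruct (bounded_seq_cluster_point (fun n => fst (z n)) (- rho) rho) as [x [_ Hx]].
  { intros n. assert (H1 := re_le_Cmod (z n)). specialize (H n). unfold Re in H1.
    apply Rabs_le_between. lra. }
  destruct (functional_choice (fun n p => (n <= p)%nat /\ Rabs (fst (z p) - x) < / INR (S n)))
    as [phi Hphi].
  { intros n. destruct (Hx (/ INR (S n)) n) as [p Hp]; [|now exists p].
    apply Rinv_0_lt_compat, lt_0_INR; lia. }
  destruct (bounded_seq_cluster_point (fun n => snd (z (phi n))) (- rho) rho) as [y [_ Hy]].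
  { intros n. assert (H1 := im_le_Cmod (z (phi n))). specialize (H (phi n)).
    apply Rabs_le_between. lra. }
  assert (Hacc : forall eps N, 0 < eps ->
            exists n, (N <= n)%nat /\ Cmod (z n - (x, y))%C < eps).
  { intros eps N He.
    destruct (archimed_cor1 (eps / 2) ltac:(lra)) as [K [HK HK0]].
    destruct (Hy (eps / 2) (N + K)%nat ltac:(lra)) as [n [Hn Hyn]].
    destruct (Hphi n) as [Hn1 Hxn].
    exists (phi n). split; [lia|].
    eapply Rle_lt_trans; [apply Cmod_le_abs_sum|]. simpl.
    assert (/ INR (S n) <= / INR K).
    { apply Rinv_le_contravar; [apply lt_0_INR; lia|]. apply le_INR; lia. }
    unfold Rminus in *. lra. }
  exists (x, y). split; [|exact Hacc].
  apply Rnot_lt_le. intros Hlt.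
  destruct (Hacc (Cmod (x, y) - rho) 0%nat ltac:(lra)) as [n [_ Hn]].
  specialize (H n).
  assert (H1 : Cmod (x, y) <= Cmod (z n) + Cmod (z n - (x, y))%C).
  { replace (x, y) with (z n + - (z n - (x, y)))%C at 1 by ring.
    rewrite <- (Cmod_opp (z n - (x, y))%C). apply Cmod_triangle. }
  lra.
Qed.

(** * Goursat's lemma for triangles *)

Lemma RtoC_half : RtoC (/ 2) = (/ 2)%C.
Proof. apply RtoC_inv. lra. Qed.

Lemma Cmod_segment (a v : C) (rho t : R) :
  Cmod a <= rho -> Cmod (a + v)%C <= rho -> 0 <= t <= 1 ->
  Cmod (a + t * v)%C <= rho.
Proof.
  intros Ha Hv Ht.
  replace (a + t * v)%C with (RtoC (1 - t) * a + RtoC t * (a + v))%C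
    by (rewrite RtoC_minus; ring).
  eapply Rle_trans; [apply Cmod_triangle|].
  rewrite !Cmod_mult, !Cmod_R, !Rabs_pos_eq by lra. nra.
Qed.

Lemma in_disc_segment (a v : C) (t : R) :
  in_disc a -> in_disc (a + v)%C -> 0 <= t <= 1 -> in_disc (a + t * v)%C.
Proof.
  intros Ha Hv Ht. unfold in_disc in *.
  apply Rle_lt_trans with (Rmax (Cmod a) (Cmod (a + v)%C)).
  - apply Cmod_segment; [apply Rmax_l|apply Rmax_r|easy].
  - now apply Rmax_lub_lt.
Qed.

Lemma continuous_along (f : C -> C) (a v w : C) (t : R) :
  continuous_on_disc f -> in_disc (a + t * v)%C ->
  continuous (fun s : R => Re (w * f (a + s * v))%C) t.
Proof.
  intros Hf Ht. apply filterlim_locally. intros eps.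
  assert (Hw := Cmod_ge_0 w). assert (Hv := Cmod_ge_0 v).
  destruct (Hf _ Ht (eps / (1 + Cmod w))) as [d [Hd H]].
  { apply Rdiv_lt_0_compat; [apply cond_pos|lra]. }
  assert (Hd' : 0 < d / (1 + Cmod v)) by (apply Rdiv_lt_0_compat; lra).
  exists (mkposreal _ Hd'). intros s Hs.
  change (Rabs (s - t) < d / (1 + Cmod v)) in Hs.
  change (Rabs (Re (w * f (a + s * v))%C - Re (w * f (a + t * v))%C) < eps).
  specialize (H (RtoC (s - t) * v)%C).
  replace (a + t * v + RtoC (s - t) * v)%C with (a + s * v)%C in H
    by (rewrite RtoC_minus; ring).
  rewrite Cmod_mult, Cmod_R in H.
  assert (Hst := Rabs_pos (s - t)).
  apply (Rmult_lt_compat_r (1 + Cmod v)) in Hs; [|lra].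
  unfold Rdiv in Hs at 1. rewrite Rmult_assoc, Rinv_l, Rmult_1_r in Hs by lra.
  specialize (H ltac:(nra)).
  apply (Rmult_lt_compat_r (1 + Cmod w)) in H; [|lra].
  unfold Rdiv in H. rewrite Rmult_assoc, Rinv_l, Rmult_1_r in H by lra.
  replace (Re (w * f (a + s * v))%C - Re (w * f (a + t * v))%C)
    with (Re (w * (f (a + s * v) - f (a + t * v)))%C)
    by (unfold Re; simpl; ring).
  eapply Rle_lt_trans; [apply re_le_Cmod|]. rewrite Cmod_mult.
  assert (H0 := Cmod_ge_0 (f (a + s * v) - f (a + t * v))%C). nra.
Qed.

(** Real part of the line integral of [f] from [a] to [a + v]. The segment is given by its direction
    [v], which makes halving and reversal simple substitutions. *)
Definition segment_integral (f : C -> C) (a v : C) : R :=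
  RInt (fun t : R => Re (v * f (a + t * v))%C) 0 1.

Lemma ex_segment_integral (f : C -> C) (a v w : C) :
  continuous_on_disc f -> in_disc a -> in_disc (a + v)%C ->
  ex_RInt (fun t : R => Re (w * f (a + t * v))%C) 0 1.
Proof.
  intros Hf Ha Hv. apply (ex_RInt_continuous (V := R_CompleteNormedModule)). intros t Ht.
  rewrite Rmin_left, Rmax_right in Ht by lra.
  apply continuous_along; [easy|]. now apply in_disc_segment.
Qed.

Lemma segment_integral_opp (f : C -> C) (a v : C) :
  continuous_on_disc f -> in_disc a -> in_disc (a + v)%C ->
  segment_integral f (a + v) (- v) = - segment_integral f a v.
Proof.
  intros Hf Ha Hv. unfold segment_integral.
  assert (Hex := ex_segment_integral f a v v Hf Ha Hv).
  set (g := fun t : R => Re (v * f (a + t * v))%C) in *.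
  change (- RInt g 0 1) with (opp (RInt g 0 1)).
  rewrite (opp_RInt_swap (V := R_CompleteNormedModule) g 0 1) by easy.
  assert (H := RInt_comp_lin (V := R_CompleteNormedModule) g (-1) 1 0 1).
  replace (-1 * 0 + 1) with 1 in H by ring.
  replace (-1 * 1 + 1) with 0 in H by ring.
  rewrite <- H by now apply ex_RInt_swap.
  apply RInt_ext. intros t _. unfold g, scal; simpl; unfold mult; simpl.
  replace (a + v + t * - v)%C with (a + RtoC (-1 * t + 1) * v)%C
    by (rewrite RtoC_plus, RtoC_mult; ring).
  unfold Re; simpl. ring.
Qed.

Lemma segment_integral_halves (f : C -> C) (a v : C) :
  continuous_on_disc f -> in_disc a -> in_disc (a + v)%C ->
  segment_integral f a v =
  segment_integral f a (v / 2) + segment_integral f (a + v / 2) (v / 2).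
Proof.
  intros Hf Ha Hv. unfold segment_integral.
  assert (Hex := ex_segment_integral f a v v Hf Ha Hv).
  set (g := fun t : R => Re (v * f (a + t * v))%C) in *.
  assert (Hex1 : ex_RInt g 0 (/ 2))
    by (apply (ex_RInt_Chasles_1 (V := R_CompleteNormedModule) g 0 (/2) 1); [lra|easy]).
  assert (Hex2 : ex_RInt g (/ 2) 1)
    by (apply (ex_RInt_Chasles_2 (V := R_CompleteNormedModule) g 0 (/2) 1); [lra|easy]).
  rewrite <- (RInt_Chasles (V := R_CompleteNormedModule) g 0 (/ 2) 1) by easy.
  apply (f_equal2 Rplus).
  - assert (H := RInt_comp_lin (V := R_CompleteNormedModule) g (/ 2) 0 0 1).
    replace (/ 2 * 0 + 0) with 0 in H by ring.
    replace (/ 2 * 1 + 0) with (/ 2) in H by ring.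
    rewrite <- H by easy.
    apply RInt_ext. intros t _.
    change (/ 2 * Re (v * f (a + RtoC (/ 2 * t + 0) * v))%C
            = Re (v / 2 * f (a + t * (v / 2)))%C).
    replace (a + t * (v / 2))%C with (a + RtoC (/ 2 * t + 0) * v)%C
      by (rewrite Rplus_0_r, RtoC_mult, RtoC_half; unfold Cdiv; ring).
    replace (v / 2)%C with (RtoC (/ 2) * v)%C
      by (rewrite RtoC_half; unfold Cdiv; ring).
    unfold Re; simpl. ring.
  - assert (H := RInt_comp_lin (V := R_CompleteNormedModule) g (/ 2) (/ 2) 0 1).
    replace (/ 2 * 0 + / 2) with (/ 2) in H by ring.
    replace (/ 2 * 1 + / 2) with 1 in H by field.
    rewrite <- H by easy.
    apply RInt_ext. intros t _.
    change (/ 2 * Re (v * f (a + RtoC (/ 2 * t + / 2) * v))%C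
            = Re (v / 2 * f (a + v / 2 + t * (v / 2)))%C).
    replace (a + v / 2 + t * (v / 2))%C with (a + RtoC (/ 2 * t + / 2) * v)%C
      by (rewrite RtoC_plus, RtoC_mult, RtoC_half; unfold Cdiv; ring).
    replace (v / 2)%C with (RtoC (/ 2) * v)%C
      by (rewrite RtoC_half; unfold Cdiv; ring).
    unfold Re; simpl. ring.
Qed.

(** The line integral of an affine map is exactly [v] times its value at the midpoint, so the error
    is at most the length times the uniform distance to the affine map. *)
Lemma segment_integral_affine_approx (f : C -> C) (a v p al be : C) (eta : R) :
  continuous_on_disc f -> in_disc a -> in_disc (a + v)%C ->
  (forall t : R, 0 <= t <= 1 ->
     Cmod (f (a + t * v) - (al + be * (a + t * v - p)))%C <= eta) ->
  Rabs (segment_integral f a v - Re (v * (al + be * (a + v / 2 - p)))%C)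
    <= Cmod v * eta.
Proof.
  intros Hf Ha Hv H. unfold segment_integral.
  assert (Hex := ex_segment_integral f a v v Hf Ha Hv).
  set (g := fun t : R => Re (v * f (a + t * v))%C) in *.
  set (l := fun t : R => Re (v * (al + be * (a + t * v - p)))%C).
  assert (Hl : is_RInt l 0 1 (Re (v * (al + be * (a + v / 2 - p)))%C)).
  { set (k := fun t : R => t * Re (v * (al + be * (a - p)))%C
                           + t ^ 2 / 2 * Re (v * (be * v))%C).
    replace (Re (v * (al + be * (a + v / 2 - p)))%C) with (minus (k 1) (k 0)).
    2:{ unfold k, minus, plus, opp; simpl.
        replace (v / 2)%C with (RtoC (/ 2) * v)%C
          by (rewrite RtoC_half; unfold Cdiv; ring).
        unfold Re; simpl. field. }
    apply (is_RInt_derive (V := R_CompleteNormedModule) k l).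
    - intros t _. unfold k, l. auto_derive; [easy|]. unfold Re; simpl. field.
    - intros t _. apply (ex_derive_continuous (V := R_NormedModule)).
      unfold l, Re; simpl. auto_derive. easy. }
  assert (Hd := is_RInt_minus g l 0 1 _ _ (RInt_correct _ _ _ Hex) Hl).
  replace (Cmod v * eta) with ((1 - 0) * (Cmod v * eta)) by ring.
  refine (norm_RInt_le_const (V := R_NormedModule) _ 0 1 _ (Cmod v * eta) Rle_0_1 _ Hd).
  intros t Ht.
  change (Rabs (g t - l t) <= Cmod v * eta).
  unfold g, l.
  replace (Re (v * f (a + t * v))%C - Re (v * (al + be * (a + t * v - p)))%C)
    with (Re (v * (f (a + t * v) - (al + be * (a + t * v - p))))%C)
    by (unfold Re; simpl; ring).
  eapply Rle_trans; [apply re_le_Cmod|]. rewrite Cmod_mult.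
  apply Rmult_le_compat_l; [apply Cmod_ge_0|]. now apply H.
Qed.

Definition triangle_integral (f : C -> C) (a v w : C) : R :=
  segment_integral f a v + segment_integral f (a + v) (w - v)
  - segment_integral f a w.

Definition triangle_in (rho : R) (a v w : C) : Prop :=
  Cmod a <= rho /\ Cmod (a + v)%C <= rho /\ Cmod (a + w)%C <= rho.

Lemma Cmod_half (v : C) : Cmod (v / 2)%C = Cmod v / 2.
Proof.
  replace (v / 2)%C with (RtoC (/ 2) * v)%C
    by (rewrite RtoC_half; unfold Cdiv; ring).
  rewrite Cmod_mult, Cmod_R, Rabs_pos_eq by lra. lra.
Qed.

(** The midpoints cut the triangle into four similar ones whose inner sides cancel, so one of them
    carries at least a quarter of the integral. The central triangle is the one with sides
    [- (v / 2)] and [- (w / 2)]. *)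
Lemma triangle_integral_quarter (f : C -> C) (rho : R) (a v w : C) :
  continuous_on_disc f -> rho < 1 -> triangle_in rho a v w ->
  exists a' v' w',
    triangle_in rho a' v' w' /\
    Cmod v' = Cmod v / 2 /\ Cmod w' = Cmod w / 2 /\
    Cmod (a' - a)%C <= Cmod v + Cmod w /\
    Rabs (triangle_integral f a v w) <= 4 * Rabs (triangle_integral f a' v' w').
Proof.
  intros Hf Hrho [Ha [Hv Hw]].
  assert (Hv2 : Cmod (a + v / 2)%C <= rho).
  { replace (a + v / 2)%C with (a + RtoC (/ 2) * v)%C
      by (rewrite RtoC_half; unfold Cdiv; ring).
    apply Cmod_segment; [easy..|lra]. }
  assert (Hw2 : Cmod (a + w / 2)%C <= rho).
  { replace (a + w / 2)%C with (a + RtoC (/ 2) * w)%C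
      by (rewrite RtoC_half; unfold Cdiv; ring).
    apply Cmod_segment; [easy..|lra]. }
  assert (Hc : Cmod (a + v / 2 + w / 2)%C <= rho).
  { replace (a + v / 2 + w / 2)%C with (a + v + RtoC (/ 2) * (w - v))%C
      by (rewrite RtoC_half; unfold Cdiv; field).
    apply Cmod_segment; [easy| |lra].
    now replace (a + v + (w - v))%C with (a + w)%C by ring. }
  assert (Ein : forall z : C, Cmod z <= rho -> in_disc z).
  { intros z Hz. unfold in_disc. lra. }
  assert (Hsum : triangle_integral f a v w =
    triangle_integral f a (v / 2) (w / 2)
    + triangle_integral f (a + v / 2) (v / 2) (w / 2)
    + triangle_integral f (a + w / 2) (v / 2) (w / 2)
    + triangle_integral f (a + v / 2 + w / 2) (- (v / 2)) (- (w / 2))).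
  { unfold triangle_integral.
    rewrite (segment_integral_halves f a v) by auto.
    rewrite (segment_integral_halves f a w) by auto.
    rewrite (segment_integral_halves f (a + v) (w - v)); auto.
    2:{ apply Ein. now replace (a + v + (w - v))%C with (a + w)%C by ring. }
    replace (a + v + (w - v) / 2)%C with (a + v / 2 + w / 2)%C by now field.
    replace ((w - v) / 2)%C with (w / 2 - v / 2)%C by now field.
    replace (a + v / 2 + v / 2)%C with (a + v)%C by now field.
    replace (a + w / 2 + v / 2)%C with (a + v / 2 + w / 2)%C by ring.
    assert (E1 := segment_integral_opp f (a + w / 2) (v / 2) Hf).
    replace (a + w / 2 + v / 2)%C with (a + v / 2 + w / 2)%C in E1 by ring.
    rewrite E1 by auto.
    assert (E2 := segment_integral_opp f (a + v / 2) (w / 2) Hf).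
    rewrite E2 by auto.
    assert (E3 := segment_integral_opp f (a + v / 2) (w / 2 - v / 2) Hf).
    replace (a + v / 2 + (w / 2 - v / 2))%C with (a + w / 2)%C in E3 by ring.
    replace (a + v / 2 + w / 2 + - (v / 2))%C with (a + w / 2)%C by ring.
    replace (- (w / 2) - - (v / 2))%C with (- (w / 2 - v / 2))%C by ring.
    rewrite E3 by auto. ring. }
  set (T1 := triangle_integral f a (v / 2) (w / 2)) in *.
  set (T2 := triangle_integral f (a + v / 2) (v / 2) (w / 2)) in *.
  set (T3 := triangle_integral f (a + w / 2) (v / 2) (w / 2)) in *.
  set (T4 := triangle_integral f (a + v / 2 + w / 2) (- (v / 2)) (- (w / 2))) in *.
  assert (Hor : Rabs (triangle_integral f a v w) <= 4 * Rabs T1 \/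
                Rabs (triangle_integral f a v w) <= 4 * Rabs T2 \/
                Rabs (triangle_integral f a v w) <= 4 * Rabs T3 \/
                Rabs (triangle_integral f a v w) <= 4 * Rabs T4).
  { rewrite Hsum. unfold Rabs; repeat destruct Rcase_abs; lra. }
  assert (Hvp := Cmod_ge_0 v). assert (Hwp := Cmod_ge_0 w).
  destruct Hor as [H|[H|[H|H]]].
  - exists a, (v / 2)%C, (w / 2)%C. repeat split; auto using Cmod_half.
    replace (a - a)%C with (RtoC 0) by ring. rewrite Cmod_0. lra.
  - exists (a + v / 2)%C, (v / 2)%C, (w / 2)%C. repeat split; auto using Cmod_half.
    + now replace (a + v / 2 + v / 2)%C with (a + v)%C by now field.
    + replace (a + v / 2 - a)%C with (v / 2)%C by ring. rewrite Cmod_half. lra.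
  - exists (a + w / 2)%C, (v / 2)%C, (w / 2)%C. repeat split; auto using Cmod_half.
    + now replace (a + w / 2 + v / 2)%C with (a + v / 2 + w / 2)%C by ring.
    + now replace (a + w / 2 + w / 2)%C with (a + w)%C by now field.
    + replace (a + w / 2 - a)%C with (w / 2)%C by ring. rewrite Cmod_half. lra.
  - exists (a + v / 2 + w / 2)%C, (- (v / 2))%C, (- (w / 2))%C.
    repeat split; rewrite ?Cmod_opp; auto using Cmod_half.
    + now replace (a + v / 2 + w / 2 + - (v / 2))%C with (a + w / 2)%C by ring.
    + now replace (a + v / 2 + w / 2 + - (w / 2))%C with (a + v / 2)%C by ring.
    + replace (a + v / 2 + w / 2 - a)%C with (v / 2 + w / 2)%C by ring.
      eapply Rle_trans; [apply Cmod_triangle|]. rewrite !Cmod_half. lra.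
Qed.

Lemma le_of_forall_pos_scale (x K : R) :
  (forall eta, 0 < eta -> x <= eta * K) -> x <= 0.
Proof.
  intros H. apply Rnot_lt_le. intros Hx.
  assert (H0 : 0 < x / (2 * (1 + Rabs K))).
  { apply Rdiv_lt_0_compat; [easy|]. assert (h := Rabs_pos K). lra. }
  specialize (H _ H0).
  assert (HK := Rle_abs K). assert (HK0 := Rabs_pos K).
  assert (E : x / (2 * (1 + Rabs K)) * (1 + Rabs K) = x / 2) by (field; lra).
  nra.
Qed.

Lemma triangle_integral_sequence (f : C -> C) (rho : R) (a v w : C) :
  continuous_on_disc f -> rho < 1 -> triangle_in rho a v w ->
  exists A V W : nat -> C,
    forall n, triangle_in rho (A n) (V n) (W n) /\
      Cmod (V n) = Cmod v / 2 ^ n /\ Cmod (W n) = Cmod w / 2 ^ n /\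
      Cmod (A (S n) - A n)%C <= (Cmod v + Cmod w) / 2 ^ n /\
      Rabs (triangle_integral f a v w)
        <= 4 ^ n * Rabs (triangle_integral f (A n) (V n) (W n)).
Proof.
  intros Hf Hrho Hin.
  pose (T := fun x : C * C * C =>
    Rabs (triangle_integral f (fst (fst x)) (snd (fst x)) (snd x))).
  pose (I := fun x : C * C * C => triangle_in rho (fst (fst x)) (snd (fst x)) (snd x)).
  (* The relation is an implication from [I x], so it is total and choice yields a function on all
     triples; iterating it never leaves [I]. *)
  destruct (functional_choice (fun x y : C * C * C =>
    I x -> I y /\
    Cmod (snd (fst y)) = Cmod (snd (fst x)) / 2 /\ Cmod (snd y) = Cmod (snd x) / 2 /\
    Cmod (fst (fst y) - fst (fst x))%C <= Cmod (snd (fst x)) + Cmod (snd x) /\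
    T x <= 4 * T y)) as [g Hg].
  { intros x. destruct (classic (I x)) as [Hx|Hx]; [|now exists x].
    destruct (triangle_integral_quarter f rho _ _ _ Hf Hrho Hx)
      as [a' [v' [w' H]]].
    now exists (a', v', w'). }
  pose (X := fun n => Nat.iter n g (a, v, w)).
  assert (HX : forall n, I (X n) /\
    Cmod (snd (fst (X n))) = Cmod v / 2 ^ n /\ Cmod (snd (X n)) = Cmod w / 2 ^ n /\
    Rabs (triangle_integral f a v w) <= 4 ^ n * T (X n)).
  { induction n as [|n [IH1 [IH2 [IH3 IH4]]]].
    - repeat split; try apply Hin; unfold X, T; simpl; lra.
    - destruct (Hg (X n) IH1) as [H1 [H2 [H3 [_ H5]]]].
      change (X (S n)) with (g (X n)).
      assert (Hp : 2 ^ n <> 0) by (apply pow_nonzero; lra).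
      assert (Hp4 : 0 < 4 ^ n) by (apply pow_lt; lra).
      split; [easy|]. rewrite H2, H3, IH2, IH3. simpl.
      repeat split; try (field; easy). nra. }
  exists (fun n => fst (fst (X n))), (fun n => snd (fst (X n))), (fun n => snd (X n)).
  intros n. destruct (HX n) as [H1 [H2 [H3 H4]]].
  repeat split; try apply H1; try easy.
  destruct (Hg (X n) H1) as [_ [_ [_ [H5 _]]]].
  change (X (S n)) with (g (X n)).
  eapply Rle_trans; [exact H5|]. rewrite H2, H3. lra.
Qed.

Lemma Cmod_sub_triangle (x y z : C) :
  Cmod (x - z)%C <= Cmod (x - y)%C + Cmod (y - z)%C.
Proof.
  replace (x - z)%C with ((x - y) + (y - z))%C by ring. apply Cmod_triangle.
Qed.

Lemma Cmod_sub_sym (x y : C) : Cmod (x - y)%C = Cmod (y - x)%C.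
Proof. rewrite <- Cmod_opp. f_equal. ring. Qed.

Lemma Cmod_sub_le (x y : C) : Cmod x <= Cmod y + Cmod (x - y)%C.
Proof. replace x with (y + (x - y))%C at 1 by ring. apply Cmod_triangle. Qed.

(** The subtracted term [2 * D / 2 ^ (n + k)] lets the induction on [k] close: each new step is
    exactly paid for by its decrease. *)
Lemma geometric_steps_tail (A : nat -> C) (D : R) :
  (forall n, Cmod (A (S n) - A n)%C <= D / 2 ^ n) ->
  forall n k, Cmod (A (n + k)%nat - A n)%C <= 2 * D / 2 ^ n - 2 * D / 2 ^ (n + k).
Proof.
  intros H n k. induction k as [|k IH].
  - rewrite Nat.add_0_r. replace (A n - A n)%C with (RtoC 0) by ring.
    rewrite Cmod_0. lra.
  - eapply Rle_trans; [apply (Cmod_sub_triangle _ (A (n + k)%nat))|].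
    rewrite Nat.add_succ_r.
    specialize (H (n + k)%nat).
    assert (Hp : 2 ^ (n + k) <> 0) by (apply pow_nonzero; lra).
    replace (2 * D / 2 ^ S (n + k)) with (D / 2 ^ (n + k)) by (simpl; field; easy).
    lra.
Qed.

(** The nested triangles shrink to a point [p], near which [f] is affine up to [eta |z - p|]. Affine
    maps integrate to zero over a triangle; the remainder is side length times error, both of order
    [2^-n], which compensates the factor [4^n] and leaves a multiple of the arbitrary [eta]. *)
Lemma goursat_triangle (f : C -> C) (a v w : C) :
  holomorphic_on_disc f ->
  in_disc a -> in_disc (a + v)%C -> in_disc (a + w)%C ->
  triangle_integral f a v w = 0.
Proof.
  intros Hhol Ha Hv Hw.
  assert (Hf := holomorphic_continuous f Hhol).
  set (rho := Rmax (Cmod a) (Rmax (Cmod (a + v)%C) (Cmod (a + w)%C))).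
  assert (Hrho : rho < 1) by now repeat apply Rmax_lub_lt.
  assert (Hin : triangle_in rho a v w).
  { repeat split; unfold rho.
    - apply Rmax_l.
    - eapply Rle_trans; [|apply Rmax_r]. apply Rmax_l.
    - eapply Rle_trans; [|apply Rmax_r]. apply Rmax_r. }
  clearbody rho.
  destruct (triangle_integral_sequence f rho a v w Hf Hrho Hin) as [A [V [W H]]].
  set (D := Cmod v + Cmod w) in *.
  assert (HD : 0 <= D).
  { unfold D. assert (h1 := Cmod_ge_0 v). assert (h2 := Cmod_ge_0 w). lra. }
  destruct (bounded_Cseq_cluster_point A rho) as [p [Hp Hacc]].
  { intros n. apply H. }
  assert (Htail := geometric_steps_tail A D (fun n => proj1 (proj2 (proj2 (proj2 (H n)))))).
  assert (HAp : forall n, Cmod (A n - p)%C <= 2 * D / 2 ^ n).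
  { intros n. apply Rnot_lt_le. intros Hlt.
    destruct (Hacc (Cmod (A n - p)%C - 2 * D / 2 ^ n) n ltac:(lra)) as [m [Hm Hmp]].
    specialize (Htail n (m - n)%nat).
    replace (n + (m - n))%nat with m in Htail by lia.
    assert (h : 0 <= 2 * D / 2 ^ m).
    { apply Rmult_le_pos; [lra|]. left. apply Rinv_0_lt_compat, pow_lt; lra. }
    assert (h1 := Cmod_sub_triangle (A n) (A m) p).
    rewrite (Cmod_sub_sym (A n) (A m)) in h1. lra. }
  apply Rabs_eq_0, Rle_antisym; [|apply Rabs_pos].
  (* The perimeter of the [n]-th triangle is at most [2 D / 2^n] and its points lie within
     [3 D / 2^n] of [p], whence [6 = 2 * 3]. *)
  apply (le_of_forall_pos_scale _ (6 * D ^ 2)).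
  intros eta Heta.
  assert (Hpd : in_disc p) by (unfold in_disc; lra).
  destruct (holomorphic_has_derivative f Hhol p Hpd eta Heta) as [d [Hd Hder]].
  set (be := C_derive f p) in *.
  assert (Hsmall : exists n, 3 * D / 2 ^ n < d).
  { destruct (pow_lt_1_zero (/ 2) ltac:(rewrite Rabs_pos_eq; lra)
               (d / (1 + 3 * D))) as [n Hn].
    { apply Rdiv_lt_0_compat; lra. }
    exists n. specialize (Hn n (Nat.le_refl n)).
    rewrite Rabs_pos_eq in Hn by (apply pow_le; lra).
    rewrite pow_inv in Hn.
    assert (Hi : 0 < / 2 ^ n) by (apply Rinv_0_lt_compat, pow_lt; lra).
    apply (Rmult_lt_compat_r (1 + 3 * D)) in Hn; [|lra].
    unfold Rdiv in Hn. rewrite (Rmult_assoc d), Rinv_l, Rmult_1_r in Hn by lra.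
    unfold Rdiv. nra. }
  destruct Hsmall as [n Hn].
  destruct (H n) as [[HA1 [HA2 HA3]] [HV [HW [_ HT]]]].
  specialize (HAp n).
  assert (Hpn : 0 < 2 ^ n) by (apply pow_lt; lra).
  assert (Hnear : forall z, Cmod (z - p)%C <= 3 * D / 2 ^ n ->
     Cmod (f z - (f p + be * (z - p)))%C <= eta * (3 * D / 2 ^ n)).
  { intros z Hz. specialize (Hder (z - p)%C ltac:(lra)).
    replace (p + (z - p))%C with z in Hder by ring.
    replace (f z - (f p + be * (z - p)))%C with (f z - f p - (z - p) * be)%C by ring.
    eapply Rle_trans; [exact Hder|]. apply Rmult_le_compat_l; lra. }
  assert (HVW : Cmod (V n) + Cmod (W n) = D / 2 ^ n).
  { rewrite HV, HW. unfold D. field. lra. }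
  assert (HV0 := Cmod_ge_0 (V n)). assert (HW0 := Cmod_ge_0 (W n)).
  assert (Hin1 : in_disc (A n)) by (unfold in_disc; lra).
  assert (Hin2 : in_disc (A n + V n)%C) by (unfold in_disc; lra).
  assert (Hin3 : in_disc (A n + W n)%C) by (unfold in_disc; lra).
  assert (Ediv : 3 * D / 2 ^ n = 2 * D / 2 ^ n + D / 2 ^ n) by (field; lra).
  assert (Hclose : forall x s, Cmod s <= D / 2 ^ n -> (x = A n + s)%C ->
            Cmod (x - p)%C <= 3 * D / 2 ^ n).
  { intros x s Hs ->. replace (A n + s - p)%C with (A n - p + s)%C by ring.
    eapply Rle_trans; [apply Cmod_triangle|]. lra. }
  assert (Hside : forall t (z : C), 0 <= t <= 1 -> Cmod (t * z)%C <= Cmod z).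
  { intros t z Ht. rewrite Cmod_mult, Cmod_R, Rabs_pos_eq by lra.
    assert (h := Cmod_ge_0 z). nra. }
  assert (HWV : Cmod (W n - V n)%C <= Cmod (V n) + Cmod (W n)).
  { unfold Cminus. eapply Rle_trans; [apply Cmod_triangle|]. rewrite Cmod_opp. lra. }
  assert (B1 := segment_integral_affine_approx f (A n) (V n) p (f p) be
    (eta * (3 * D / 2 ^ n)) Hf Hin1 Hin2).
  assert (B2 := segment_integral_affine_approx f (A n + V n) (W n - V n) p (f p) be
    (eta * (3 * D / 2 ^ n)) Hf Hin2).
  assert (B3 := segment_integral_affine_approx f (A n) (W n) p (f p) be
    (eta * (3 * D / 2 ^ n)) Hf Hin1 Hin3).
  replace (A n + V n + (W n - V n))%C with (A n + W n)%C in B2 by ring.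
  specialize (B2 Hin3).
  specialize (B1 ltac:(intros t Ht; apply Hnear, (Hclose _ (t * V n)%C); [|ring];
    specialize (Hside t (V n) Ht); lra)).
  specialize (B3 ltac:(intros t Ht; apply Hnear, (Hclose _ (t * W n)%C); [|ring];
    specialize (Hside t (W n) Ht); lra)).
  assert (Hmid : forall t, 0 <= t <= 1 -> Cmod (V n + t * (W n - V n))%C <= D / 2 ^ n).
  { intros t Ht. apply Cmod_segment; [lra| |easy].
    replace (V n + (W n - V n))%C with (W n) by ring. lra. }
  specialize (B2 ltac:(intros t Ht;
    apply Hnear, (Hclose _ (V n + t * (W n - V n))%C); [now apply Hmid|ring])).
  (* The midpoint values of the affine approximation, weighted by the sides, add up to its integral
     over the closed triangle, which is zero. *)
  assert (Hzero : Re (V n * (f p + be * (A n + V n / 2 - p)))%C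
     + Re ((W n - V n) * (f p + be * (A n + V n + (W n - V n) / 2 - p)))%C
     - Re (W n * (f p + be * (A n + W n / 2 - p)))%C = 0).
  { assert (E : (V n * (f p + be * (A n + V n / 2 - p))
     + (W n - V n) * (f p + be * (A n + V n + (W n - V n) / 2 - p))
     - W n * (f p + be * (A n + W n / 2 - p)))%C = RtoC 0) by field.
    apply (f_equal Re) in E. unfold Re in *. simpl in *. lra. }
  assert (HTn : Rabs (triangle_integral f (A n) (V n) (W n))
     <= 2 * (D / 2 ^ n) * (eta * (3 * D / 2 ^ n))).
  { unfold triangle_integral.
    set (s1 := segment_integral f (A n) (V n)) in *.
    set (s2 := segment_integral f (A n + V n) (W n - V n)) in *.
    set (s3 := segment_integral f (A n) (W n)) in *.
    set (r1 := Re _) in B1. set (r2 := Re _) in B2. set (r3 := Re _) in B3.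
    fold r1 r2 r3 in Hzero.
    replace (s1 + s2 - s3) with ((s1 - r1) + (s2 - r2) - (s3 - r3)) by lra.
    assert (He : 0 <= eta * (3 * D / 2 ^ n)).
    { apply Rmult_le_pos; [lra|]. apply Rmult_le_pos; [lra|].
      left. now apply Rinv_0_lt_compat. }
    set (e := eta * (3 * D / 2 ^ n)) in *.
    assert (H12 : Rabs (s1 - r1 + (s2 - r2) - (s3 - r3))
       <= Rabs (s1 - r1) + Rabs (s2 - r2) + Rabs (s3 - r3)).
    { unfold Rabs; repeat destruct Rcase_abs; lra. }
    nra. }
  eapply Rle_trans; [exact HT|].
  replace (eta * (6 * D ^ 2)) with (4 ^ n * (2 * (D / 2 ^ n) * (eta * (3 * D / 2 ^ n)))).
  - apply Rmult_le_compat_l; [|easy]. apply pow_le; lra.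
  - replace 4 with (2 * 2) by ring. rewrite Rpow_mult_distr. field. lra.
Qed.

(** * Bloch functions on a radius *)

Definition real_primitive (f : C -> C) (z : C) : R := segment_integral f 0 z.

(** Goursat's lemma for the triangle with vertices [0], [z], [z + h]. *)
Lemma real_primitive_increment (f : C -> C) (z h : C) :
  holomorphic_on_disc f -> in_disc z -> in_disc (z + h)%C ->
  real_primitive f (z + h) - real_primitive f z = segment_integral f z h.
Proof.
  intros Hf Hz Hh.
  assert (H := goursat_triangle f 0 z (z + h) Hf).
  rewrite !Cplus_0_l in H.
  specialize (H ltac:(unfold in_disc; rewrite Cmod_0; lra) Hz Hh).
  unfold triangle_integral in H. rewrite Cplus_0_l in H.
  replace (z + h - z)%C with h in H by ring.
  unfold real_primitive. lra.
Qed.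

Lemma segment_integral_near (f : C -> C) (z : C) (eta : R) :
  continuous_on_disc f -> in_disc z -> 0 < eta ->
  exists d, 0 < d /\ forall h, Cmod h < d ->
    in_disc (z + h)%C /\
    Rabs (segment_integral f z h - Re (h * f z)%C) <= Cmod h * eta.
Proof.
  intros Hf Hz Heta.
  destruct (Hf z Hz eta Heta) as [d [Hd H]].
  exists (Rmin d (1 - Cmod z)). unfold in_disc in Hz.
  split; [apply Rmin_pos; lra|]. intros h Hh.
  assert (H1 := Rlt_le_trans _ _ _ Hh (Rmin_l _ _)).
  assert (H2 := Rlt_le_trans _ _ _ Hh (Rmin_r _ _)).
  assert (Hzh : in_disc (z + h)%C).
  { unfold in_disc. eapply Rle_lt_trans; [apply Cmod_triangle|]. lra. }
  split; [easy|].
  replace (h * f z)%C with (h * (f z + 0 * (z + h / 2 - z)))%C by ring.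
  apply segment_integral_affine_approx; auto.
  intros t Ht. replace (f z + 0 * (z + t * h - z))%C with (f z) by ring.
  left. apply H. rewrite Cmod_mult, Cmod_R, Rabs_pos_eq by lra.
  assert (h0 := Cmod_ge_0 h). nra.
Qed.

Lemma is_derive_real_primitive (f : C -> C) (z h : C) (t : R) :
  holomorphic_on_disc f -> in_disc (z + t * h)%C ->
  is_derive (fun s : R => real_primitive f (z + s * h)) t (Re (h * f (z + t * h))%C).
Proof.
  intros Hhol Ht. assert (Hf := holomorphic_continuous f Hhol).
  apply is_derive_Reals. intros eps Heps.
  assert (Hh := Cmod_ge_0 h).
  destruct (segment_integral_near f _ (eps / (2 * (1 + Cmod h))) Hf Ht) as [d [Hd H]].
  { apply Rdiv_lt_0_compat; lra. }
  assert (Hd' : 0 < d / (1 + Cmod h)) by (apply Rdiv_lt_0_compat; lra).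
  exists (mkposreal _ Hd'). intros k Hk Hkd. simpl in Hkd.
  assert (Hk0 := Rabs_pos_lt k Hk).
  assert (Hkd' : Rabs k * (1 + Cmod h) < d).
  { apply (Rmult_lt_compat_r (1 + Cmod h)) in Hkd; [|lra].
    unfold Rdiv in Hkd. now rewrite Rmult_assoc, Rinv_l, Rmult_1_r in Hkd by lra. }
  destruct (H (k * h)%C) as [Hin HH].
  { rewrite Cmod_mult, Cmod_R. nra. }
  replace (z + RtoC (t + k) * h)%C with (z + t * h + k * h)%C by (rewrite RtoC_plus; ring).
  rewrite (real_primitive_increment f _ _ Hhol Ht Hin).
  set (s := segment_integral _ _ _) in *.
  replace (Re (k * h * f (z + t * h))%C) with (k * Re (h * f (z + t * h))%C) in HH
    by (unfold Re; simpl; ring).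
  set (r := Re _) in *.
  replace (s / k - r) with ((s - k * r) / k) by (field; easy).
  unfold Rdiv. rewrite Rabs_mult, Rabs_inv.
  rewrite Cmod_mult, Cmod_R in HH.
  apply Rmult_lt_reg_r with (Rabs k); [easy|].
  rewrite Rmult_assoc, Rinv_l, Rmult_1_r by lra.
  eapply Rle_lt_trans; [exact HH|].
  assert (E : Cmod h * (eps / (2 * (1 + Cmod h))) < eps).
  { apply Rmult_lt_reg_r with (2 * (1 + Cmod h)); [lra|].
    replace (Cmod h * (eps / (2 * (1 + Cmod h))) * (2 * (1 + Cmod h)))
      with (Cmod h * eps) by (field; lra). nra. }
  nra.
Qed.

Lemma is_derive_Re_along (f : C -> C) (z h w l : C) (t : R) :
  has_derivative f (z + t * h)%C l ->
  is_derive (fun s : R => Re (w * f (z + s * h))%C) t (Re (w * (h * l))%C).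
Proof.
  intros Hl. apply is_derive_Reals. intros eps Heps.
  assert (Hh := Cmod_ge_0 h). assert (Hw := Cmod_ge_0 w).
  assert (Hp : 0 <= Cmod w * Cmod h) by nra.
  destruct (Hl (eps / (2 * (1 + Cmod w * Cmod h)))) as [d [Hd H]].
  { apply Rdiv_lt_0_compat; lra. }
  assert (Hd' : 0 < d / (1 + Cmod h)) by (apply Rdiv_lt_0_compat; lra).
  exists (mkposreal _ Hd'). intros k Hk Hkd. simpl in Hkd.
  assert (Hk0 := Rabs_pos_lt k Hk).
  assert (Hkd' : Rabs k * (1 + Cmod h) < d).
  { apply (Rmult_lt_compat_r (1 + Cmod h)) in Hkd; [|lra].
    unfold Rdiv in Hkd. now rewrite Rmult_assoc, Rinv_l, Rmult_1_r in Hkd by lra. }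
  specialize (H (k * h)%C). rewrite !Cmod_mult, Cmod_R in H.
  specialize (H ltac:(nra)).
  replace (z + RtoC (t + k) * h)%C with (z + t * h + k * h)%C by (rewrite RtoC_plus; ring).
  set (A := f (z + t * h + k * h)%C) in *. set (B := f (z + t * h)%C) in *.
  replace ((Re (w * A)%C - Re (w * B)%C) / k - Re (w * (h * l))%C)
    with (Re (w * (A - B - k * h * l))%C / k) by (unfold Re; simpl; field; easy).
  unfold Rdiv. rewrite Rabs_mult, Rabs_inv.
  apply Rmult_lt_reg_r with (Rabs k); [easy|].
  rewrite Rmult_assoc, Rinv_l, Rmult_1_r by lra.
  eapply Rle_lt_trans; [apply re_le_Cmod|]. rewrite Cmod_mult.
  assert (E : (Cmod w * Cmod h) * (eps / (2 * (1 + Cmod w * Cmod h))) < eps).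
  { set (c := Cmod w * Cmod h) in *.
    apply Rmult_lt_reg_r with (2 * (1 + c)); [lra|].
    replace (c * (eps / (2 * (1 + c))) * (2 * (1 + c))) with (c * eps) by (field; lra).
    nra. }
  set (e := eps / (2 * (1 + Cmod w * Cmod h))) in *.
  apply Rle_lt_trans with (Cmod w * (e * (Rabs k * Cmod h))).
  - apply Rmult_le_compat_l; easy.
  - replace (Cmod w * (e * (Rabs k * Cmod h))) with (Cmod w * Cmod h * e * Rabs k) by ring.
    apply Rmult_lt_compat_r; easy.
Qed.

Lemma nonneg_derivative_le (g dg : R -> R) (a b : R) :
  a <= b ->
  (forall x, a <= x <= b -> is_derive g x (dg x)) ->
  (forall x, a <= x <= b -> 0 <= dg x) -> g a <= g b.
Proof.
  intros Hab Hd Hpos.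
  destruct (MVT_gen g a b dg) as [c [Hc E]].
  - intros x Hx. rewrite Rmin_left, Rmax_right in Hx by lra. apply Hd. lra.
  - intros x Hx. rewrite Rmin_left, Rmax_right in Hx by lra.
    apply continuity_pt_filterlim.
    apply (ex_derive_continuous (V := R_NormedModule)). exists (dg x). apply Hd. lra.
  - rewrite Rmin_left, Rmax_right in Hc by lra.
    specialize (Hpos c Hc). nra.
Qed.

(** Along a line the derivative of the primitive differs from its linear part by at most [t];
    integrating gives the loss [T^2 / 2]. Only a lower bound is needed, since the four-point average
    has to be shown large. *)
Lemma real_primitive_second_order (f : C -> C) (z : C) :
  holomorphic_on_disc f -> in_disc z ->
  exists d, 0 < d /\ forall (h : C) (T : R), Cmod h = 1 -> 0 <= T < d ->
    in_disc (z + T * h)%C /\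
    real_primitive f z + T * Re (h * f z)%C + T ^ 2 / 2 * Re (h * (h * C_derive f z))%C
      - T ^ 2 / 2 <= real_primitive f (z + T * h).
Proof.
  intros Hf Hz.
  set (l := C_derive f z).
  destruct (holomorphic_has_derivative f Hf z Hz 1 ltac:(lra)) as [d [Hd H]].
  fold l in H.
  exists (Rmin d (1 - Cmod z)). unfold in_disc in *.
  split; [apply Rmin_pos; lra|]. intros h T Hh HT.
  assert (H1 := Rlt_le_trans _ _ _ (proj2 HT) (Rmin_l _ _)).
  assert (H2 := Rlt_le_trans _ _ _ (proj2 HT) (Rmin_r _ _)).
  assert (Hin : forall t, 0 <= t <= T -> in_disc (z + t * h)%C).
  { intros t Ht. unfold in_disc. eapply Rle_lt_trans; [apply Cmod_triangle|].
    rewrite Cmod_mult, Cmod_R, Hh, Rabs_pos_eq by lra. lra. }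
  split; [apply Hin; lra|].
  set (A := Re (h * f z)%C). set (B := Re (h * (h * l))%C).
  assert (Hm := nonneg_derivative_le
    (fun t : R => real_primitive f (z + t * h) - t * A - t ^ 2 / 2 * B + t ^ 2 / 2)
    (fun t : R => Re (h * f (z + t * h))%C - A - t * B + t) 0 T ltac:(lra)).
  cbv beta in Hm.
  replace (z + 0 * h)%C with z in Hm by ring.
  assert (real_primitive f z - 0 * A - 0 ^ 2 / 2 * B + 0 ^ 2 / 2
    <= real_primitive f (z + T * h) - T * A - T ^ 2 / 2 * B + T ^ 2 / 2); [|simpl in *; lra].
  apply Hm.
  - intros t Ht.
    assert (D1 := is_derive_real_primitive f z h t Hf (Hin t Ht)).
    assert (D2 : is_derive (fun t : R => t * A + t ^ 2 / 2 * B - t ^ 2 / 2) t (A + t * B - t)).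
    { auto_derive; [easy|]. field. }
    assert (D := is_derive_minus (V := R_NormedModule) _ _ _ _ _ D1 D2).
    eapply is_derive_ext; [|replace (Re (h * f (z + t * h))%C - A - t * B + t)
      with (minus (Re (h * f (z + t * h))%C) (A + t * B - t));
      [exact D|unfold minus, plus, opp; simpl; ring]].
    intros s. unfold minus, plus, opp; simpl. ring.
  - intros t Ht. specialize (H (t * h)%C).
    rewrite Cmod_mult, Cmod_R, Hh, Rabs_pos_eq in H by lra.
    specialize (H ltac:(lra)).
    assert (Hr : Rabs (Re (h * (f (z + t * h) - f z - t * h * l))%C) <= t).
    { eapply Rle_trans; [apply re_le_Cmod|]. rewrite Cmod_mult, Hh. lra. }
    replace (Re (h * (f (z + t * h) - f z - t * h * l))%C)
      with (Re (h * f (z + t * h))%C - A - t * B) in Hr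
      by (unfold A, B, Re; simpl; ring).
    apply Rabs_le_between in Hr. lra.
Qed.

Lemma Cmod_sqr (z : C) : Cmod z ^ 2 = fst z ^ 2 + snd z ^ 2.
Proof. apply Cmod2_alt. Qed.

(* Adding [|z|^2] makes the harmonic function strictly subharmonic, so that its four-point
   average around an interior point strictly exceeds its value there. *)
Definition bumped_primitive (f : C -> C) (z : C) : R := real_primitive f z + Cmod z ^ 2.

(** Over the directions [1, -1, i, -i] both [h] and [h^2] sum to zero, so the first and second order
    terms disappear. The Taylor losses total [2 T^2], while the four values of [|z|^2] gain
    [4 T^2]. *)
Lemma bumped_primitive_no_interior_max (f : C -> C) (z : C) :
  holomorphic_on_disc f -> in_disc z ->
  exists w, in_disc w /\ bumped_primitive f z < bumped_primitive f w.
Proof.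
  intros Hf Hz.
  destruct (real_primitive_second_order f z Hf Hz) as [d [Hd H]].
  set (T := d / 2).
  assert (HT : 0 <= T < d) by (unfold T; lra).
  assert (HT0 : 0 < T) by (unfold T; lra).
  destruct (H 1 T Cmod_1 HT) as [I1 H1].
  destruct (H (- (1))%C T Cmod_m1 HT) as [I2 H2].
  destruct (H Ci T Cmod_Ci HT) as [I3 H3].
  destruct (H (- Ci)%C T ltac:(rewrite Cmod_opp; apply Cmod_Ci) HT) as [I4 H4].
  apply NNPP. intros Hno.
  assert (Hmax : forall w, in_disc w -> bumped_primitive f w <= bumped_primitive f z).
  { intros w Hw. apply Rnot_lt_le. intros Hlt. apply Hno. now exists w. }
  apply Hmax in I1, I2, I3, I4. unfold bumped_primitive in *.
  rewrite !Cmod_sqr in *.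
  set (u0 := real_primitive f z) in *.
  set (u1 := real_primitive f (z + T * 1)) in *.
  set (u2 := real_primitive f (z + T * - (1))) in *.
  set (u3 := real_primitive f (z + T * Ci)) in *.
  set (u4 := real_primitive f (z + T * - Ci)) in *.
  unfold Re in *. simpl in *. nra.
Qed.

Lemma on_circle_scale_in_disc (zeta : C) (r : R) :
  on_circle zeta -> 0 <= r < 1 -> in_disc (r * zeta)%C.
Proof.
  intros Hz Hr. unfold in_disc. rewrite Cmod_mult, Cmod_R, Hz, Rabs_pos_eq by lra. lra.
Qed.

(* Integrating [|f'| <= M / (1 - r)] twice: the second primitive of [1 / (1 - r)] vanishing to
   second order at [rho] is [(1-r) ln ((1-r)/(1-rho)) + r - rho <= r - rho]. *)
Lemma bloch_radial_growth (f : C -> C) (M rho r : R) (zeta : C) :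
  holomorphic_on_disc f ->
  (forall z, in_disc z -> (1 - Cmod z ^ 2) * Cmod (C_derive f z) <= M) ->
  on_circle zeta -> 0 <= rho <= r -> r < 1 ->
  real_primitive f (r * zeta) <=
    real_primitive f (rho * zeta) + (r - rho) * (Re (zeta * f (rho * zeta))%C + M).
Proof.
  intros Hf HM Hz Hrho Hr.
  assert (HM0 : 0 <= M).
  { specialize (HM 0%C ltac:(unfold in_disc; rewrite Cmod_0; lra)).
    rewrite Cmod_0 in HM. assert (h := Cmod_ge_0 (C_derive f 0)). nra. }
  set (A := fun t : R => Re (zeta * f (0 + t * zeta))%C).
  assert (Hin : forall t, 0 <= t < 1 -> in_disc (0 + t * zeta)%C).
  { intros t Ht. rewrite Cplus_0_l. now apply on_circle_scale_in_disc. }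
  assert (HA : forall t, rho <= t <= r ->
            A t <= A rho - M * (ln (1 - t) - ln (1 - rho))).
  { intros t Ht.
    assert (Hm := nonneg_derivative_le
      (fun s => - M * ln (1 - s) - A s)
      (fun s => M / (1 - s) - Re (zeta * (zeta * C_derive f (0 + s * zeta)))%C) rho t
      ltac:(lra)). cbv beta in Hm.
    assert (- M * ln (1 - rho) - A rho <= - M * ln (1 - t) - A t); [|lra].
    apply Hm.
    - intros s Hs.
      assert (D1 : is_derive (fun s => - M * ln (1 - s)) s (M / (1 - s))).
      { auto_derive; [lra|field; lra]. }
      assert (D2 := is_derive_Re_along f 0 zeta zeta _ s
        (holomorphic_has_derivative f Hf _ (Hin s ltac:(lra)))).
      exact (is_derive_minus (V := R_NormedModule) _ _ _ _ _ D1 D2).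
    - intros s Hs.
      specialize (HM _ (Hin s ltac:(lra))).
      assert (E : Cmod (0 + s * zeta)%C = s).
      { rewrite Cplus_0_l, Cmod_mult, Cmod_R, Hz, Rabs_pos_eq by lra. lra. }
      rewrite E in HM.
      set (l := C_derive f (0 + s * zeta)) in *.
      assert (Hl : Re (zeta * (zeta * l))%C <= Cmod l).
      { eapply Rle_trans; [apply Rle_abs|]. eapply Rle_trans; [apply re_le_Cmod|].
        rewrite !Cmod_mult, Hz. lra. }
      assert (Hl0 := Cmod_ge_0 l).
      assert (Cmod l <= M / (1 - s)); [|lra].
      apply Rle_div_r; [lra|]. nra. }
  assert (Hm := nonneg_derivative_le
    (fun s => s * A rho + M * ((1 - s) * (ln (1 - s) - ln (1 - rho)) + s)
              - real_primitive f (0 + s * zeta))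
    (fun s => A rho - M * (ln (1 - s) - ln (1 - rho)) - A s) rho r ltac:(lra)).
  cbv beta in Hm.
  assert (Hln : ln (1 - r) <= ln (1 - rho)) by (apply ln_le; lra).
  rewrite !Cplus_0_l in Hm.
  replace (Re (zeta * f (rho * zeta))%C) with (A rho) by (unfold A; now rewrite Cplus_0_l).
  enough (Hm' : rho * A rho + M * ((1 - rho) * (ln (1 - rho) - ln (1 - rho)) + rho)
               - real_primitive f (rho * zeta)
             <= r * A rho + M * ((1 - r) * (ln (1 - r) - ln (1 - rho)) + r)
               - real_primitive f (r * zeta)).
  { assert (M * ((1 - r) * (ln (1 - r) - ln (1 - rho))) <= 0).
    { assert ((1 - r) * (ln (1 - r) - ln (1 - rho)) <= 0) by nra. nra. }
    nra. }
  apply Hm.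
  - intros s Hs.
    assert (D1 : is_derive
      (fun s => s * A rho + M * ((1 - s) * (ln (1 - s) - ln (1 - rho)) + s)) s
      (A rho - M * (ln (1 - s) - ln (1 - rho)))).
    { auto_derive; [lra|unfold Rminus; field; lra]. }
    assert (D2 := is_derive_real_primitive f 0 zeta s Hf (Hin s ltac:(lra))).
    exact (is_derive_minus (V := R_NormedModule) _ _ _ _ _ D1 D2).
  - intros s Hs. specialize (HA s Hs). lra.
Qed.

Lemma polar_form (z : C) : exists zeta, on_circle zeta /\ z = (Cmod z * zeta)%C.
Proof.
  destruct (classic (z = 0%C)) as [->|Hz].
  - exists 1%C. split; [apply Cmod_1|]. rewrite Cmod_0. ring.
  - assert (H := proj1 (Cmod_gt_0 z) Hz).
    assert (HC : RtoC (Cmod z) <> 0%C) by (intros E; apply RtoC_inj in E; lra).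
    exists (z / Cmod z)%C. split.
    + unfold on_circle. rewrite Cmod_div, Cmod_R, Rabs_pos_eq by (easy || lra).
      field. lra.
    + field. easy.
Qed.

Lemma bumped_primitive_continuous (f : C -> C) (z : C) (eta : R) :
  holomorphic_on_disc f -> in_disc z -> 0 < eta ->
  exists d, 0 < d /\ forall h, Cmod h < d ->
    Rabs (bumped_primitive f (z + h) - bumped_primitive f z) < eta.
Proof.
  intros Hf Hz Heta.
  destruct (segment_integral_near f z 1 (holomorphic_continuous f Hf) Hz ltac:(lra))
    as [d [Hd H]].
  (* For [|h| < 1] the primitive moves by at most [(|f z| + 1) |h|] and [|z|^2] by at most [2 |h|];
     5 leaves room for a strict inequality. *)
  set (K := Cmod (f z) + 5).
  assert (HK : 5 <= K) by (unfold K; assert (h := Cmod_ge_0 (f z)); lra).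
  exists (Rmin d (Rmin 1 (eta / K))).
  assert (0 < eta / K) by (apply Rdiv_lt_0_compat; lra).
  split; [repeat apply Rmin_pos; lra|]. intros h Hh.
  assert (H1 := Rlt_le_trans _ _ _ Hh (Rmin_l _ _)).
  assert (H2 := Rlt_le_trans _ _ _ Hh (Rmin_r _ _)).
  assert (H3 := Rlt_le_trans _ _ _ H2 (Rmin_l _ _)).
  assert (H4 := Rlt_le_trans _ _ _ H2 (Rmin_r _ _)).
  apply (Rmult_lt_compat_r K) in H4; [|lra].
  unfold Rdiv in H4. rewrite Rmult_assoc, Rinv_l, Rmult_1_r in H4 by lra.
  destruct (H h H1) as [Hin Hs].
  unfold bumped_primitive.
  assert (Hu := real_primitive_increment f z h Hf Hz Hin).
  assert (Hre := re_le_Cmod (h * f z)%C). rewrite Cmod_mult in Hre.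
  assert (T1 := Cmod_triangle z h).
  assert (T2 := Cmod_triangle (z + h)%C (- h)%C).
  replace (z + h + - h)%C with z in T2 by ring. rewrite Cmod_opp in T2.
  assert (P0 := Cmod_ge_0 z). assert (P1 := Cmod_ge_0 (z + h)%C).
  assert (P2 := Cmod_ge_0 h). unfold in_disc in *.
  assert (Q : Rabs (Cmod (z + h)%C ^ 2 - Cmod z ^ 2) <= 2 * Cmod h).
  { apply Rabs_le_between. split; simpl; nra. }
  apply Rabs_le_between in Q, Hs, Hre. unfold K in H4.
  apply Rabs_def1; nra.
Qed.

Lemma bloch_bumped_primitive_bounded (f : C -> C) (M : R) :
  holomorphic_on_disc f ->
  (forall z, in_disc z -> (1 - Cmod z ^ 2) * Cmod (C_derive f z) <= M) ->
  exists B, forall z, in_disc z -> bumped_primitive f z <= B.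
Proof.
  intros Hf HM. set (K := Rmax 0 (Cmod (f 0%C) + M)).
  exists (real_primitive f 0 + K + 1). intros z Hz.
  destruct (polar_form z) as [zeta [Hc E]].
  assert (P := Cmod_ge_0 z). unfold in_disc in Hz.
  assert (G := bloch_radial_growth f M 0 (Cmod z) zeta Hf HM Hc ltac:(lra) Hz).
  rewrite <- E in G. replace (RtoC 0 * zeta)%C with (RtoC 0) in G by ring.
  assert (Hre : Re (zeta * f 0)%C <= Cmod (f 0%C)).
  { eapply Rle_trans; [apply Rle_abs|]. eapply Rle_trans; [apply re_le_Cmod|].
    rewrite Cmod_mult, Hc. lra. }
  assert (K0 : 0 <= K) by apply Rmax_l.
  assert (K1 : Cmod (f 0%C) + M <= K) by apply Rmax_r.
  unfold bumped_primitive. nra.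
Qed.

(** Were the real part below [- (M + 2)] at some [rho], then on radii close to [p] the primitive
    would drop from radius [rho] to radius [r] by more than [2 (r - rho)], whereas [|z|^2] regains
    only [r^2 - rho^2 <= 2 (r - rho)]: this is the origin of the 2. Points near [p] would then stay
    below the supremum [S] by a fixed amount. *)
Lemma bloch_radial_half_plane (f : C -> C) (M : R) :
  holomorphic_on_disc f ->
  (forall z, in_disc z -> (1 - Cmod z ^ 2) * Cmod (C_derive f z) <= M) ->
  exists p, on_circle p /\
    forall rho, 0 <= rho < 1 -> - (M + 2) <= Re (p * f (rho * p))%C.
Proof.
  intros Hf HM.
  assert (H0 : in_disc 0) by (unfold in_disc; rewrite Cmod_0; lra).
  destruct (completeness (fun y => exists z, in_disc z /\ y = bumped_primitive f z))
    as [S [HS1 HS2]].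
  { destruct (bloch_bumped_primitive_bounded f M Hf HM) as [B HB].
    exists B. intros y [z [Hz ->]]. auto. }
  { exists (bumped_primitive f 0), 0%C. auto. }
  assert (Hub : forall z, in_disc z -> bumped_primitive f z <= S).
  { intros z Hz. apply HS1. now exists z. }
  destruct (functional_choice (fun n z =>
    in_disc z /\ S - / INR (Datatypes.S n) < bumped_primitive f z))
    as [z Hz].
  { intros n. apply NNPP. intros Hno.
    assert (Hn : 0 < / INR (Datatypes.S n)) by (apply Rinv_0_lt_compat, lt_0_INR; lia).
    assert (S <= S - / INR (Datatypes.S n)); [|lra].
    apply HS2. intros y [w [Hw ->]]. apply Rnot_lt_le. intros Hlt.
    apply Hno. now exists w. }
  destruct (bounded_Cseq_cluster_point z 1) as [p [Hp Hacc]].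
  { intros n. left. apply Hz. }
  assert (Hlate : forall eps d, 0 < eps -> 0 < d -> exists w, in_disc w /\
            Cmod (w - p)%C < d /\ S - eps < bumped_primitive f w).
  { intros eps d He Hd. destruct (archimed_cor1 eps He) as [N [HN HN0]].
    destruct (Hacc d N Hd) as [n [Hn Hnp]]. exists (z n).
    destruct (Hz n) as [Hz1 Hz2]. repeat split; auto.
    assert (/ INR (Datatypes.S n) <= / INR N); [|lra].
    apply Rinv_le_contravar; [apply lt_0_INR; lia|]. apply le_INR; lia. }
  assert (Hpc : on_circle p).
  { destruct Hp as [Hp|Hp]; [|easy]. exfalso.
    destruct (bumped_primitive_no_interior_max f p Hf Hp) as [w [Hw Hlt]].
    set (e := (bumped_primitive f w - bumped_primitive f p) / 2).
    assert (He : 0 < e) by (unfold e; lra).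
    destruct (bumped_primitive_continuous f p e Hf Hp He) as [d [Hd Hc]].
    destruct (Hlate e d He Hd) as [x [Hx [Hxp HxS]]].
    specialize (Hc _ Hxp). replace (p + (x - p))%C with x in Hc by ring.
    apply Rabs_def2 in Hc. specialize (Hub w Hw). unfold e in *. lra. }
  exists p. split; [easy|]. intros rho Hrho. apply Rnot_lt_le. intros Hlt.
  (* Half of the deficit: one [k] is spent on moving from [p] to a nearby [q], the other remains for
     the contradiction. *)
  set (k := (- (M + 2) - Re (p * f (rho * p))%C) / 2).
  assert (Hk : 0 < k) by (unfold k; lra).
  assert (Hcont : exists d, 0 < d /\ forall q, on_circle q -> Cmod (q - p)%C < d ->
            Re (q * f (rho * q))%C < - (M + 2) - k).
  { set (b := Cmod (f (rho * p)%C)). assert (Hb : 0 <= b) by apply Cmod_ge_0.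
    destruct (holomorphic_continuous f Hf _ (on_circle_scale_in_disc p rho Hpc Hrho)
      (k / 2) ltac:(lra)) as [d [Hd Hfc]].
    assert (Hkb : 0 < k / (2 * (1 + b))) by (apply Rdiv_lt_0_compat; lra).
    exists (Rmin d (k / (2 * (1 + b)))). split; [apply Rmin_pos; lra|].
    intros q Hq Hqp.
    assert (H1 := Rlt_le_trans _ _ _ Hqp (Rmin_l _ _)).
    assert (H2 := Rlt_le_trans _ _ _ Hqp (Rmin_r _ _)).
    assert (P := Cmod_ge_0 (q - p)%C).
    specialize (Hfc (rho * (q - p))%C).
    rewrite Cmod_mult, Cmod_R, Rabs_pos_eq in Hfc by lra.
    specialize (Hfc ltac:(nra)).
    replace (rho * p + rho * (q - p))%C with (rho * q)%C in Hfc by ring.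
    assert (E : Re (q * f (rho * q))%C = Re (p * f (rho * p))%C
      + Re (q * (f (rho * q) - f (rho * p)) + (q - p) * f (rho * p))%C)
      by (unfold Re; simpl; ring).
    assert (B : Re (q * (f (rho * q) - f (rho * p)) + (q - p) * f (rho * p))%C
       <= Cmod (f (rho * q) - f (rho * p))%C + Cmod (q - p)%C * b).
    { eapply Rle_trans; [apply Rle_abs|]. eapply Rle_trans; [apply re_le_Cmod|].
      eapply Rle_trans; [apply Cmod_triangle|]. rewrite !Cmod_mult, Hq.
      unfold b. lra. }
    assert (B2 : Cmod (q - p)%C * b <= k / 2).
    { apply Rle_trans with (k / (2 * (1 + b)) * (1 + b)); [nra|].
      right. field. lra. }
    unfold k in *. lra. }
  destruct Hcont as [d [Hd Hcont]].
  (* Within [(1 - rho) / 2] of [p] one has [|w| - rho > (1 - rho) / 2], so the loss exceeds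
     [k (1 - rho) / 2]. The radius [d / 2] suffices because projecting [w] to the circle costs
     [1 - |w| <= |w - p|] once more. *)
  destruct (Hlate (k * (1 - rho) / 2) (Rmin (d / 2) ((1 - rho) / 2)))
    as [w [Hw [Hwp HwS]]].
  { nra. }
  { apply Rmin_pos; lra. }
  assert (H1 := Rlt_le_trans _ _ _ Hwp (Rmin_l _ _)).
  assert (H2 := Rlt_le_trans _ _ _ Hwp (Rmin_r _ _)).
  assert (Hr : 1 - Cmod w <= Cmod (w - p)%C).
  { rewrite <- Hpc, Cmod_sub_sym. assert (h := Cmod_sub_le p w). lra. }
  destruct (polar_form w) as [zeta [Hc E]].
  assert (Hw' := Hw). unfold in_disc in Hw'.
  assert (Hzp : Cmod (zeta - p)%C < d).
  { assert (Hzw : Cmod (zeta - w)%C = 1 - Cmod w).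
    { rewrite E at 1. replace (zeta - Cmod w * zeta)%C with (RtoC (1 - Cmod w) * zeta)%C
        by (rewrite RtoC_minus; ring).
      rewrite Cmod_mult, Cmod_R, Hc, Rabs_pos_eq by lra. lra. }
    assert (h := Cmod_sub_triangle zeta w p). lra. }
  specialize (Hcont zeta Hc Hzp).
  assert (G := bloch_radial_growth f M rho (Cmod w) zeta Hf HM Hc ltac:(lra) Hw').
  rewrite <- E in G.
  assert (Hrz := Hub _ (on_circle_scale_in_disc zeta rho Hc Hrho)).
  unfold bumped_primitive in *.
  rewrite Cmod_mult, Cmod_R, Hc, Rabs_pos_eq in Hrz by lra.
  set (r := Cmod w) in *. set (X := Re (zeta * f (rho * zeta))%C) in *.
  nra.
Qed.

Lemma no_bloch_universal (f : C -> C) : U_R f -> bloch f -> False.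
Proof.
  intros [_ HU] [Hf [M HM]].
  destruct (bloch_radial_half_plane f M Hf HM) as [p [Hp H]].
  (* Multiplied by [p], this target becomes [- (M + 4)], two units outside the half plane; an
     approximation within distance 1 is already impossible. *)
  destruct (HU p Hp Hp (Fin (RtoC (- (M + 4)) * Cconj p)%C)) as [s [Hs [_ Hlim]]].
  (* Balls of [C] are products here: each coordinate is within [/ 2], hence the modulus within 1. *)
  assert (Hl := proj1 (filterlim_locally _ _) Hlim (mkposreal (/ 2) ltac:(lra))).
  destruct Hl as [N HN]. specialize (HN N (Nat.le_refl N)).
  specialize (H (s N) (Hs N)).
  set (y := f (s N * p)%C) in *.
  destruct HN as [B1 B2].
  change (Rabs (fst y - fst (RtoC (- (M + 4)) * Cconj p)%C) < / 2) in B1.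
  change (Rabs (snd y - snd (RtoC (- (M + 4)) * Cconj p)%C) < / 2) in B2.
  set (a := (RtoC (- (M + 4)) * Cconj p)%C) in *.
  assert (Hd : Cmod (y - a)%C <= 1).
  { eapply Rle_trans; [apply Cmod_le_abs_sum|].
    change (Rabs (fst y - fst a) + Rabs (snd y - snd a) <= 1). lra. }
  assert (Hpa : Re (p * a)%C = - (M + 4)).
  { assert (h := Cmod_sqr p). rewrite Hp in h. unfold a, Re. simpl in *.
    transitivity (- (M + 4) * (fst p * (fst p * 1) + snd p * (snd p * 1))); [ring|].
    rewrite <- h. ring. }
  assert (Hpy : Re (p * y)%C <= Re (p * a)%C + 1).
  { replace (Re (p * y)%C) with (Re (p * a)%C + Re (p * (y - a))%C) by (unfold Re; simpl; ring).
    apply Rplus_le_compat_l. eapply Rle_trans; [apply Rle_abs|].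
    eapply Rle_trans; [apply re_le_Cmod|]. rewrite Cmod_mult, Hp. lra. }
  lra.
Qed.

(** * The lacunary series *)

(** Gives convergence and an explicit bound at once, since the partial sums stay below
    [u 0 - u (S n)]. *)
Lemma series_telescoping_bound (b u : nat -> R) :
  (forall j, 0 <= b j <= u j - u (S j)) -> (forall j, 0 <= u j) ->
  ex_series b /\ Series b <= u 0%nat.
Proof.
  intros Hb Hu.
  assert (Hs : forall n, sum_n b n <= u 0%nat - u (S n)).
  { induction n as [|n IH].
    - rewrite sum_O. apply Hb.
    - rewrite sum_Sn. unfold plus; simpl. specialize (Hb (S n)). lra. }
  assert (Hex : ex_finite_lim_seq (sum_n b)).
  { apply (ex_finite_lim_seq_incr _ (u 0%nat)).
    - intros n. rewrite sum_Sn. unfold plus; simpl. specialize (Hb (S n)). lra.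
    - intros n. specialize (Hs n). specialize (Hu (S n)). lra. }
  destruct Hex as [l Hl].
  assert (Hser : is_series b l) by exact Hl.
  split; [now exists l|].
  rewrite (is_series_unique _ _ Hser).
  assert (H := is_lim_seq_le (sum_n b) (fun _ => u 0%nat) l (u 0%nat)).
  apply H; [|exact Hl|apply is_lim_seq_const].
  intros n. specialize (Hs n). specialize (Hu (S n)). lra.
Qed.

(** [Series] is a total function, so this value is meaningful only together with convergence;
    absolute convergence, [Csummable], is the form that passes to both coordinates. *)
Definition Cseries (c : nat -> C) : C :=
  (Series (fun j => fst (c j)), Series (fun j => snd (c j))).

Definition Csummable (c : nat -> C) : Prop := ex_series (fun j => Cmod (c j)).

Lemma Csummable_le (c : nat -> C) (b : nat -> R) :
  (forall j, Cmod (c j) <= b j) -> ex_series b -> Csummable c.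
Proof.
  intros H Hb. apply (ex_series_le (K := R_AbsRing) (V := R_CompleteNormedModule) _ b); [|easy].
  intros j. change (Rabs (Cmod (c j)) <= b j).
  rewrite Rabs_pos_eq by apply Cmod_ge_0. apply H.
Qed.

Lemma Csummable_fst (c : nat -> C) : Csummable c -> ex_series (fun j => fst (c j)).
Proof.
  intros H. apply (ex_series_le (K := R_AbsRing) (V := R_CompleteNormedModule) _
    (fun j => Cmod (c j))); [|easy].
  intros j. apply re_le_Cmod.
Qed.

Lemma Csummable_snd (c : nat -> C) : Csummable c -> ex_series (fun j => snd (c j)).
Proof.
  intros H. apply (ex_series_le (K := R_AbsRing) (V := R_CompleteNormedModule) _
    (fun j => Cmod (c j))); [|easy].
  intros j. apply im_le_Cmod.
Qed.

Lemma Rabs_Series_le (a b : nat -> R) :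
  (forall j, Rabs (a j) <= b j) -> ex_series b -> Rabs (Series a) <= Series b.
Proof.
  intros H Hb.
  eapply Rle_trans.
  - apply Series_Rabs.
    apply (ex_series_le (K := R_AbsRing) (V := R_CompleteNormedModule) _ b); [|easy].
    intros j. change (Rabs (Rabs (a j)) <= b j). now rewrite Rabs_Rabsolu.
  - apply Series_le; [|easy]. intros j. split; [apply Rabs_pos|apply H].
Qed.

(* The factor [2] is lost by estimating the two coordinates separately. *)
Lemma Cmod_Cseries_le (c : nat -> C) (b : nat -> R) :
  (forall j, Cmod (c j) <= b j) -> ex_series b -> Cmod (Cseries c) <= 2 * Series b.
Proof.
  intros H Hb. eapply Rle_trans; [apply Cmod_le_abs_sum|]. simpl.
  assert (H1 : Rabs (Series (fun j => fst (c j))) <= Series b).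
  { apply Rabs_Series_le; [|easy]. intros j.
    eapply Rle_trans; [apply re_le_Cmod|apply H]. }
  assert (H2 : Rabs (Series (fun j => snd (c j))) <= Series b).
  { apply Rabs_Series_le; [|easy]. intros j.
    eapply Rle_trans; [apply im_le_Cmod|apply H]. }
  lra.
Qed.

Lemma Cseries_minus (c d : nat -> C) : Csummable c -> Csummable d ->
  (Cseries c - Cseries d)%C = Cseries (fun j => (c j - d j)%C).
Proof.
  intros Hc Hd. unfold Cseries, Cminus, Cplus, Copp. simpl. f_equal.
  - exact (eq_sym (Series_minus (fun j => fst (c j)) (fun j => fst (d j))
      (Csummable_fst _ Hc) (Csummable_fst _ Hd))).
  - exact (eq_sym (Series_minus (fun j => snd (c j)) (fun j => snd (d j))
      (Csummable_snd _ Hc) (Csummable_snd _ Hd))).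
Qed.

Lemma Csummable_scal (h : C) (c : nat -> C) :
  Csummable c -> Csummable (fun j => (h * c j)%C).
Proof.
  intros Hc. apply (ex_series_ext (fun j => Cmod h * Cmod (c j))).
  - intros j. symmetry. apply Cmod_mult.
  - apply (ex_series_scal (K := R_AbsRing) (V := R_NormedModule) (Cmod h) _ Hc).
Qed.

Lemma Cseries_scal (h : C) (c : nat -> C) : Csummable c ->
  (h * Cseries c)%C = Cseries (fun j => (h * c j)%C).
Proof.
  intros Hc. destruct h as [x y].
  assert (H1 := Csummable_fst c Hc). assert (H2 := Csummable_snd c Hc).
  assert (S1 : forall x, ex_series (fun j => x * fst (c j))) by
    (intros x'; now apply (ex_series_scal (K := R_AbsRing) (V := R_NormedModule))).
  assert (S2 : forall x, ex_series (fun j => x * snd (c j))) by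
    (intros x'; now apply (ex_series_scal (K := R_AbsRing) (V := R_NormedModule))).
  unfold Cseries, Cmult. simpl. f_equal.
  - rewrite Series_minus by auto. now rewrite !Series_scal_l.
  - rewrite Series_plus by auto. now rewrite !Series_scal_l.
Qed.

Fixpoint Cpartial_sum (c : nat -> C) (k : nat) : C :=
  match k with
  | O => 0%C
  | S j => (Cpartial_sum c j + c j)%C
  end.

Lemma Cseries_split (c : nat -> C) (k : nat) : Csummable c ->
  Cseries c = (Cpartial_sum c k + Cseries (fun j => c (k + j)%nat))%C.
Proof.
  intros Hc. induction k as [|k IH]; simpl; [now rewrite Cplus_0_l|].
  rewrite IH, <- Cplus_assoc. f_equal.
  assert (Hk : Csummable (fun j => c (k + j)%nat)).
  { unfold Csummable. now apply (ex_series_incr_n (fun j => Cmod (c j)) k). }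
  unfold Cseries at 1.
  rewrite Series_incr_1 by exact (Csummable_fst _ Hk).
  rewrite (Series_incr_1 (fun j => snd (c (k + j)%nat))) by exact (Csummable_snd _ Hk).
  rewrite Nat.add_0_r.
  unfold Cseries, Cplus; simpl. f_equal; f_equal; apply Series_ext; intros j;
    now rewrite Nat.add_succ_r.
Qed.

Lemma Cpartial_sum_minus (c d : nat -> C) (k : nat) :
  (Cpartial_sum c k - Cpartial_sum d k)%C = Cpartial_sum (fun j => (c j - d j)%C) k.
Proof.
  induction k as [|k IH]; simpl; [ring|]. rewrite <- IH. ring.
Qed.

Fixpoint freq (k : nat) : nat :=
  match k with
  | O => 1
  | S j => freq j * (4 * (S j * S j))
  end.

Definition coef (k : nat) : R := / sqrt (INR (S k)).

Lemma INR_freq_S (k : nat) : INR (freq (S k)) = INR (freq k) * (4 * INR (S k) ^ 2).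
Proof.
  change (freq (S k)) with (freq k * (4 * (S k * S k)))%nat.
  rewrite !mult_INR. replace (INR 4) with 4 by (simpl; ring). ring.
Qed.

Lemma INR_S_ge_1 (k : nat) : 1 <= INR (S k).
Proof. change 1 with (INR 1). apply le_INR. lia. Qed.

Lemma INR_freq_ge_1 (k : nat) : 1 <= INR (freq k).
Proof.
  induction k as [|k IH]; [simpl; lra|].
  rewrite INR_freq_S. assert (h := INR_S_ge_1 k). nra.
Qed.

Lemma INR_freq_growth (k : nat) : 4 * INR (freq k) <= INR (freq (S k)).
Proof.
  rewrite INR_freq_S. assert (h := INR_S_ge_1 k). assert (h1 := INR_freq_ge_1 k).
  assert (1 <= INR (S k) ^ 2) by (set (x := INR (S k)) in *; nra). nra.
Qed.

Lemma freq_pos (k : nat) : (0 < freq k)%nat.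
Proof. apply INR_lt. assert (h := INR_freq_ge_1 k). simpl. lra. Qed.

Lemma coef_bounds (k : nat) : 0 < coef k <= 1.
Proof.
  unfold coef. assert (h := INR_S_ge_1 k).
  assert (1 <= sqrt (INR (S k))) by (rewrite <- sqrt_1; apply sqrt_le_1_alt; easy).
  split; [apply Rinv_0_lt_compat; lra|].
  rewrite <- Rinv_1. apply Rinv_le_contravar; lra.
Qed.

Lemma coef_sqr (k : nat) : coef k ^ 2 = / INR (S k).
Proof.
  unfold coef. rewrite pow_inv, pow2_sqrt by apply pos_INR. reflexivity.
Qed.

(** The right side is [1 - rho] times a sum of [k + 1] powers of [rho], each at least
    [rho ^ (m + k)]. *)
Lemma geometric_gap (rho : R) (m k : nat) : 0 <= rho <= 1 ->
  INR (S k) * rho ^ (m + k) * (1 - rho) <= rho ^ m - rho ^ (m + S k).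
Proof.
  intros Hrho. induction k as [|k IH].
  - rewrite Nat.add_0_r, Nat.add_1_r. simpl. lra.
  - rewrite !Nat.add_succ_r in *.
    rewrite (S_INR (S k)).
    assert (Hp : 0 <= rho ^ (m + k)) by (apply pow_le; lra).
    assert (H0 : 0 <= INR (S k)) by apply pos_INR.
    simpl pow in *. set (x := rho ^ (m + k)) in *.
    assert (H1 : 0 <= INR (S k) * x * (1 - rho)) by (repeat apply Rmult_le_pos; lra).
    assert (H2 : rho * (INR (S k) * x * (1 - rho)) <= INR (S k) * x * (1 - rho)) by nra.
    nra.
Qed.

Lemma pow_weighted_le (rho : R) (n : nat) : 0 <= rho < 1 ->
  INR n * rho ^ (n - 1) <= / (1 - rho).
Proof.
  intros Hrho. assert (Hi : 0 < / (1 - rho)) by (apply Rinv_0_lt_compat; lra).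
  destruct n as [|n]; [simpl; lra|].
  replace (S n - 1)%nat with n by lia.
  assert (H := geometric_gap rho 0 n ltac:(lra)).
  assert (Hp : 0 <= rho ^ (0 + S n)) by (apply pow_le; lra).
  replace (0 + n)%nat with n in H by lia.
  apply Rmult_le_reg_r with (1 - rho); [lra|]. rewrite Rinv_l by lra. simpl in *. lra.
Qed.

(** With [m], [n] consecutive frequencies, [4 m <= n] gives [n <= 4/3 (n - m)], and [geometric_gap]
    bounds [(n - m) rho^(n-1)] by [(rho^m - rho^n) / (1 - rho)], which telescopes. *)
Lemma derivative_series_bound (rho : R) : 0 <= rho < 1 ->
  ex_series (fun j => INR (freq j) * rho ^ (freq j - 1)) /\
  Series (fun j => INR (freq j) * rho ^ (freq j - 1)) <= 1 + 4 / 3 / (1 - rho).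
Proof.
  intros Hrho.
  set (c := 4 / 3 / (1 - rho)).
  assert (Hc : 0 < c) by (unfold c; repeat apply Rdiv_lt_0_compat; lra).
  (* The term of index 0 equals 1 because [freq 0 = 1]; it is accounted for by the 1 in the initial
     value. *)
  apply (series_telescoping_bound _ (fun j => match j with
     | O => 1 + c | S i => c * rho ^ freq i end)).
  - intros j. split.
    + apply Rmult_le_pos; [apply pos_INR|apply pow_le; lra].
    + destruct j as [|j]; [simpl; nra|].
      assert (Hg := INR_freq_growth j). assert (H1 := INR_freq_ge_1 j).
      set (m := freq j) in *. set (n := freq (S j)) in *.
      assert (Hmn : (m < n)%nat) by (apply INR_lt; lra).
      assert (G := geometric_gap rho m (n - m - 1) ltac:(lra)).
      replace (m + (n - m - 1))%nat with (n - 1)%nat in G by lia.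
      replace (S (n - m - 1)) with (n - m)%nat in G by lia.
      replace (m + (n - m))%nat with n in G by lia.
      rewrite minus_INR in G by lia.
      assert (Hp : 0 <= rho ^ (n - 1)) by (apply pow_le; lra).
      set (x := rho ^ (n - 1)) in *.
      replace (c * rho ^ m - c * rho ^ n) with (c * (rho ^ m - rho ^ n)) by ring.
      apply Rle_trans with (c * ((INR n - INR m) * x * (1 - rho))).
      2:{ apply Rmult_le_compat_l; lra. }
      replace (c * ((INR n - INR m) * x * (1 - rho))) with (4 / 3 * (INR n - INR m) * x)
        by (unfold c; field; lra).
      apply Rmult_le_compat_r; lra.
  - intros [|j]; [lra|]. apply Rmult_le_pos; [lra|apply pow_le; lra].
Qed.

(** With [rho = s^2] the term is [s^2 (n s^(n-1))^2]: one factor [n s^(n-1)] is bounded by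
    [1 / (1 - s)], the other is summable. *)
Lemma second_derivative_series (rho : R) : 0 <= rho < 1 ->
  ex_series (fun j => INR (freq j) ^ 2 * rho ^ freq j).
Proof.
  intros Hrho. set (s := sqrt rho).
  assert (Hs : 0 <= s < 1).
  { split; [apply sqrt_pos|]. unfold s. rewrite <- sqrt_1. apply sqrt_lt_1_alt. lra. }
  assert (Hss : s * s = rho) by (apply sqrt_sqrt; lra).
  apply (ex_series_le (K := R_AbsRing) (V := R_CompleteNormedModule) _
    (fun j => / (1 - s) * (INR (freq j) * s ^ (freq j - 1)))).
  - intros j. change (Rabs (INR (freq j) ^ 2 * rho ^ freq j)
      <= / (1 - s) * (INR (freq j) * s ^ (freq j - 1))).
    assert (Hp : 0 <= s ^ (freq j - 1)) by (apply pow_le; lra).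
    assert (H0 := pos_INR (freq j)).
    assert (W := pow_weighted_le s (freq j) Hs).
    rewrite Rabs_pos_eq.
    2:{ apply Rmult_le_pos; apply pow_le; lra. }
    rewrite <- Hss, Rpow_mult_distr.
    assert (E : s ^ freq j = s * s ^ (freq j - 1)).
    { assert (h := freq_pos j). replace (freq j) with (S (freq j - 1)) at 1 by lia. easy. }
    rewrite E. set (x := s ^ (freq j - 1)) in *. set (n := INR (freq j)) in *.
    replace (n ^ 2 * (s * x * (s * x))) with (s * s * ((n * x) * (n * x))) by ring.
    assert (0 <= n * x) by nra.
    apply Rle_trans with ((n * x) * (n * x)).
    + assert (0 <= (n * x) * (n * x)) by nra. nra.
    + apply Rmult_le_compat_r; easy.
  - apply (ex_series_scal (K := R_AbsRing) (V := R_NormedModule)).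
    now apply derivative_series_bound.
Qed.

Definition lacunary (z : C) : C := Cseries (fun j => (coef j * z ^ freq j)%C).

Definition lacunary_derivative (z : C) : C :=
  Cseries (fun j => (coef j * (INR (freq j) * z ^ (freq j - 1)))%C).

Lemma lacunary_derivative_term_le (z : C) (j : nat) :
  Cmod (coef j * (INR (freq j) * z ^ (freq j - 1)))%C
    <= INR (freq j) * Cmod z ^ (freq j - 1).
Proof.
  assert (h := coef_bounds j). assert (h1 := pos_INR (freq j)).
  rewrite !Cmod_mult, !Cmod_R, Cmod_pow, !Rabs_pos_eq by lra.
  assert (hp : 0 <= Cmod z ^ (freq j - 1)) by (apply pow_le, Cmod_ge_0).
  set (x := INR (freq j) * Cmod z ^ (freq j - 1)) in *.
  assert (0 <= x) by (apply Rmult_le_pos; easy). nra.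
Qed.

Lemma lacunary_term_le (z : C) (j : nat) :
  Cmod (coef j * z ^ freq j)%C <= Cmod z ^ freq j.
Proof.
  assert (h := coef_bounds j).
  rewrite Cmod_mult, Cmod_R, Cmod_pow, Rabs_pos_eq by lra.
  assert (hp : 0 <= Cmod z ^ freq j) by apply pow_le, Cmod_ge_0. nra.
Qed.

Lemma lacunary_summable (z : C) : in_disc z ->
  Csummable (fun j => (coef j * z ^ freq j)%C).
Proof.
  intros Hz. assert (P := Cmod_ge_0 z). unfold in_disc in Hz.
  apply (Csummable_le _ (fun j => INR (freq j) * Cmod z ^ (freq j - 1))).
  - intros j. eapply Rle_trans; [apply lacunary_term_le|].
    assert (E : Cmod z ^ freq j = Cmod z * Cmod z ^ (freq j - 1)).
    { assert (h := freq_pos j). replace (freq j) with (S (freq j - 1)) at 1 by lia. easy. }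
    rewrite E. assert (hp : 0 <= Cmod z ^ (freq j - 1)) by now apply pow_le.
    apply Rmult_le_compat_r; [easy|]. assert (h := INR_freq_ge_1 j). lra.
  - apply derivative_series_bound. lra.
Qed.

Lemma lacunary_derivative_summable (z : C) : in_disc z ->
  Csummable (fun j => (coef j * (INR (freq j) * z ^ (freq j - 1)))%C).
Proof.
  intros Hz. assert (P := Cmod_ge_0 z). unfold in_disc in Hz.
  apply (Csummable_le _ (fun j => INR (freq j) * Cmod z ^ (freq j - 1))).
  - intros j. apply lacunary_derivative_term_le.
  - apply derivative_series_bound. lra.
Qed.

(** The remainders satisfy [D_(n+1) = (z + h) D_n + h^2 n z^(n-1)], and [n^2 + n <= (n+1)^2]. The
    factor [rho ^ 2] on the left avoids the exponent [n - 2]. *)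
Lemma Cpow_second_order (z h : C) (rho : R) (n : nat) :
  Cmod z <= rho -> Cmod (z + h)%C <= rho ->
  Cmod ((z + h) ^ n - z ^ n - h * (INR n * z ^ (n - 1)))%C * rho ^ 2
    <= INR n ^ 2 * rho ^ n * Cmod h ^ 2.
Proof.
  intros Hz Hzh. assert (P := Cmod_ge_0 z). assert (Ph := Cmod_ge_0 h).
  induction n as [|n IH].
  - simpl. replace (1 - 1 - h * (0 * 1))%C with (RtoC 0) by ring. rewrite Cmod_0. nra.
  - set (D := ((z + h) ^ n - z ^ n - h * (INR n * z ^ (n - 1)))%C) in *.
    assert (E : ((z + h) ^ S n - z ^ S n - h * (INR (S n) * z ^ (S n - 1)))%C
       = ((z + h) * D + h * h * (INR n * z ^ (n - 1)))%C).
    { unfold D. rewrite S_INR, RtoC_plus, !Cpow_S.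
      replace (S n - 1)%nat with n by lia.
      destruct n as [|n].
      - simpl. ring.
      - replace (S n - 1)%nat with n by lia. rewrite !Cpow_S. ring. }
    rewrite E.
    assert (T := Cmod_triangle ((z + h) * D) (h * h * (INR n * z ^ (n - 1)))).
    rewrite !Cmod_mult, Cmod_R, Cmod_pow, Rabs_pos_eq in T by apply pos_INR.
    assert (PD := Cmod_ge_0 D). assert (Pn := pos_INR n).
    assert (Hn : INR n * Cmod z ^ (n - 1) * rho ^ 2 <= INR n * rho ^ S n).
    { destruct n as [|n]; [simpl; lra|]. replace (S n - 1)%nat with n by lia.
      rewrite Rmult_assoc. apply Rmult_le_compat_l; [easy|].
      replace (rho ^ S (S n)) with (rho ^ n * rho ^ 2) by (simpl; ring).
      apply Rmult_le_compat_r; [nra|]. apply pow_incr. lra. }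
    set (x := INR n * Cmod z ^ (n - 1)) in *.
    assert (H1 : Cmod (z + h)%C * Cmod D * rho ^ 2 <= rho * (INR n ^ 2 * rho ^ n * Cmod h ^ 2)).
    { rewrite Rmult_assoc. apply Rmult_le_compat; auto.
      - apply Cmod_ge_0.
      - nra. }
    assert (H2 : Cmod h * Cmod h * x * rho ^ 2 <= Cmod h ^ 2 * (INR n * rho ^ S n)).
    { replace (Cmod h * Cmod h * x * rho ^ 2) with (Cmod h ^ 2 * (x * rho ^ 2)) by ring.
      apply Rmult_le_compat_l; [nra|easy]. }
    apply Rle_trans with (rho * (INR n ^ 2 * rho ^ n * Cmod h ^ 2)
                          + Cmod h ^ 2 * (INR n * rho ^ S n)).
    { apply Rle_trans with ((Cmod (z + h)%C * Cmod D + Cmod h * Cmod h * x) * rho ^ 2).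
      - apply Rmult_le_compat_r; [nra|easy].
      - lra. }
    rewrite S_INR. simpl (rho ^ S n).
    assert (Pr : 0 <= rho * rho ^ n * Cmod h ^ 2).
    { repeat apply Rmult_le_pos; try lra. apply pow_le; lra. }
    nra.
Qed.

Lemma lacunary_has_derivative (z : C) : in_disc z ->
  has_derivative lacunary z (lacunary_derivative z).
Proof.
  intros Hz eta Heta. assert (P := Cmod_ge_0 z).
  assert (Hz' := Hz). unfold in_disc in Hz'.
  (* Halfway to the circle, so that [z + h] stays within radius [rho] for [|h| < (1 - |z|) / 2] and
     one convergent series dominates all remainders. *)
  set (rho := (1 + Cmod z) / 2).
  assert (Hrho : 0 < rho < 1) by (unfold rho; lra).
  set (K := Series (fun j => INR (freq j) ^ 2 * rho ^ freq j)).
  assert (HexK := second_derivative_series rho ltac:(lra)).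
  assert (HK : 0 <= K).
  { apply Rle_trans with (Rabs (Series (fun _ : nat => 0))); [apply Rabs_pos|].
    apply Rabs_Series_le; [|easy]. intros j. rewrite Rabs_R0.
    apply Rmult_le_pos; apply pow_le; [apply pos_INR|lra]. }
  exists (Rmin ((1 - Cmod z) / 2) (eta * rho ^ 2 / (2 * K + 1))).
  assert (Hr2 : 0 < rho ^ 2) by (apply pow_lt; lra).
  split.
  { apply Rmin_pos; [lra|]. apply Rdiv_lt_0_compat; [|lra]. nra. }
  intros h Hh. assert (Ph := Cmod_ge_0 h).
  assert (H1 := Rlt_le_trans _ _ _ Hh (Rmin_l _ _)).
  assert (H2 := Rlt_le_trans _ _ _ Hh (Rmin_r _ _)).
  assert (Hzh : Cmod (z + h)%C <= rho).
  { eapply Rle_trans; [apply Cmod_triangle|]. unfold rho. lra. }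
  assert (Hin : in_disc (z + h)%C) by (unfold in_disc; lra).
  assert (Sc := Csummable_scal h _ (lacunary_derivative_summable z Hz)).
  unfold lacunary, lacunary_derivative.
  rewrite Cseries_scal by now apply lacunary_derivative_summable.
  rewrite Cseries_minus by now apply lacunary_summable.
  rewrite Cseries_minus; [| |exact Sc].
  2:{ unfold Csummable.
      apply (Csummable_le _ (fun j => Cmod (coef j * (z + h) ^ freq j)%C
                                      + Cmod (coef j * z ^ freq j)%C)).
      - intros j. unfold Cminus. eapply Rle_trans; [apply Cmod_triangle|].
        rewrite Cmod_opp. lra.
      - apply (ex_series_plus (K := R_AbsRing) (V := R_NormedModule));
          now apply lacunary_summable. }
  eapply Rle_trans.
  - apply (Cmod_Cseries_le _ (fun j => Cmod h ^ 2 / rho ^ 2 * (INR (freq j) ^ 2 * rho ^ freq j))).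
    + intros j.
      replace (coef j * (z + h) ^ freq j - coef j * z ^ freq j
               - h * (coef j * (INR (freq j) * z ^ (freq j - 1))))%C
        with (coef j * ((z + h) ^ freq j - z ^ freq j
               - h * (INR (freq j) * z ^ (freq j - 1))))%C by ring.
      assert (hc := coef_bounds j).
      rewrite Cmod_mult, Cmod_R, Rabs_pos_eq by lra.
      assert (Q := Cpow_second_order z h rho (freq j) ltac:(unfold rho; lra) Hzh).
      set (D := Cmod ((z + h) ^ freq j - z ^ freq j
                      - h * (INR (freq j) * z ^ (freq j - 1)))%C) in *.
      assert (PD : 0 <= D) by apply Cmod_ge_0.
      apply Rle_trans with D; [nra|].
      apply Rmult_le_reg_r with (rho ^ 2); [easy|].
      eapply Rle_trans; [exact Q|]. right. field. lra.
    + now apply (ex_series_scal (K := R_AbsRing) (V := R_NormedModule)).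
  - rewrite Series_scal_l. fold K.
    apply (Rmult_lt_compat_r (2 * K + 1)) in H2; [|lra].
    unfold Rdiv in H2. rewrite Rmult_assoc, Rinv_l, Rmult_1_r in H2 by lra.
    apply Rmult_le_reg_r with (rho ^ 2); [easy|].
    replace (2 * (Cmod h ^ 2 / rho ^ 2 * K) * rho ^ 2) with (Cmod h * (Cmod h * (2 * K)))
      by (field; lra).
    replace (eta * Cmod h * rho ^ 2) with (Cmod h * (eta * rho ^ 2)) by ring.
    apply Rmult_le_compat_l; [easy|]. nra.
Qed.

Lemma lacunary_bloch : bloch lacunary.
Proof.
  split.
  - intros z Hz. exists (lacunary_derivative z).
    now apply is_derive_of_has_derivative, lacunary_has_derivative.
  (* The derivative is at most [2 (1 + 4 / (3 (1 - r)))] and [1 - r^2] cancels the pole; 10 is a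
     generous bound for the product. *)
  - exists 10. intros z Hz.
    rewrite (is_C_derive_unique lacunary z (lacunary_derivative z))
      by now apply is_derive_of_has_derivative, lacunary_has_derivative.
    assert (P := Cmod_ge_0 z). unfold in_disc in Hz.
    destruct (derivative_series_bound (Cmod z) ltac:(lra)) as [Hex HB].
    assert (HC := Cmod_Cseries_le _ _ (lacunary_derivative_term_le z) Hex).
    fold (lacunary_derivative z) in HC.
    set (x := Cmod (lacunary_derivative z)) in *. set (r := Cmod z) in *.
    assert (Hx : x <= 2 * (1 + 4 / 3 / (1 - r))) by lra.
    apply Rle_trans with ((1 - r ^ 2) * (2 * (1 + 4 / 3 / (1 - r)))).
    + apply Rmult_le_compat_l; [nra|easy].
    + replace ((1 - r ^ 2) * (2 * (1 + 4 / 3 / (1 - r)))) with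
        (2 * (1 + r) * (1 - r + 4 / 3)) by (field; lra). nra.
Qed.

(** * Radial values and partial sums *)

Definition cis (t : R) : C := (cos t, sin t).

Lemma Cmod_cis (t : R) : Cmod (cis t) = 1.
Proof.
  change (sqrt (cos t ^ 2 + sin t ^ 2) = 1).
  replace (cos t ^ 2 + sin t ^ 2) with 1; [apply sqrt_1|].
  rewrite <- (sin2_cos2 t). unfold Rsqr. ring.
Qed.

Lemma cis_plus (s t : R) : cis (s + t) = (cis s * cis t)%C.
Proof.
  unfold cis, Cmult; simpl. rewrite cos_plus, sin_plus. f_equal; ring.
Qed.

Lemma cis_pow (t : R) (n : nat) : (cis t ^ n)%C = cis (INR n * t).
Proof.
  induction n as [|n IH].
  - simpl. rewrite Rmult_0_l. unfold cis. now rewrite cos_0, sin_0.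
  - rewrite Cpow_S, IH, <- cis_plus, S_INR. f_equal. ring.
Qed.

Lemma cis_lipschitz (s t : R) : Cmod (cis s - cis t)%C <= 2 * Rabs (s - t).
Proof.
  eapply Rle_trans; [apply Cmod_le_abs_sum|].
  change (Rabs (cos s - cos t) + Rabs (sin s - sin t) <= 2 * Rabs (s - t)).
  destruct (MVT_gen cos t s (fun x => - sin x)) as [c [_ Ec]].
  { intros x _. auto_derive; [easy|ring]. }
  { intros x _. apply continuity_cos. }
  destruct (MVT_gen sin t s cos) as [d [_ Ed]].
  { intros x _. auto_derive; [easy|ring]. }
  { intros x _. apply continuity_sin. }
  rewrite Ec, Ed, !Rabs_mult, Rabs_Ropp.
  assert (h1 : Rabs (sin c) <= 1) by (apply Rabs_le; apply SIN_bound).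
  assert (h2 : Rabs (cos d) <= 1) by (apply Rabs_le; apply COS_bound).
  assert (h := Rabs_pos (s - t)). nra.
Qed.

Definition walk (k : nat) (t : R) : C :=
  Cpartial_sum (fun j => (coef j * cis (INR (freq j) * t))%C) k.

Lemma walk_S (k : nat) (t : R) :
  walk (S k) t = (walk k t + coef k * cis (INR (freq k) * t))%C.
Proof. reflexivity. Qed.

(** As frequencies grow at least fourfold, the last term dominates. Serves both for the variation of
    the walk in [t] and for the passage from the circle to a good radius. *)
Lemma Cpartial_sum_freq_bound (c : nat -> C) (X : R) (k : nat) :
  (forall j, Cmod (c j) <= X * INR (freq j)) ->
  Cmod (Cpartial_sum c (S k)) <= 2 * X * INR (freq k).
Proof.
  intros H.
  assert (HX : 0 <= X).
  { assert (h := H 0%nat). assert (h1 := Cmod_ge_0 (c 0%nat)). simpl in h. lra. }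
  induction k as [|k IH].
  - simpl. rewrite Cplus_0_l. specialize (H 0%nat). simpl in H. lra.
  - change (Cpartial_sum c (S (S k))) with (Cpartial_sum c (S k) + c (S k))%C.
    eapply Rle_trans; [apply Cmod_triangle|]. specialize (H (S k)).
    assert (h := INR_freq_growth k). assert (h1 := INR_freq_ge_1 k). nra.
Qed.

Lemma walk_lipschitz (k : nat) (s t : R) :
  Cmod (walk (S k) s - walk (S k) t)%C <= 4 * INR (freq k) * Rabs (s - t).
Proof.
  unfold walk. rewrite Cpartial_sum_minus.
  replace (4 * INR (freq k) * Rabs (s - t)) with (2 * (2 * Rabs (s - t)) * INR (freq k)) by ring.
  apply Cpartial_sum_freq_bound. intros j.
  replace (coef j * cis (INR (freq j) * s) - coef j * cis (INR (freq j) * t))%C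
    with (coef j * (cis (INR (freq j) * s) - cis (INR (freq j) * t)))%C by ring.
  assert (hc := coef_bounds j).
  rewrite Cmod_mult, Cmod_R, Rabs_pos_eq by lra.
  assert (h := cis_lipschitz (INR (freq j) * s) (INR (freq j) * t)).
  rewrite <- Rmult_minus_distr_l, Rabs_mult, (Rabs_pos_eq (INR (freq j))) in h by apply pos_INR.
  assert (h0 := Cmod_ge_0 (cis (INR (freq j) * s) - cis (INR (freq j) * t))%C). nra.
Qed.

Lemma walk_bound (k : nat) (t : R) : Cmod (walk k t) <= INR k.
Proof.
  induction k as [|k IH].
  - unfold walk; simpl. rewrite Cmod_0. lra.
  - rewrite walk_S, S_INR. eapply Rle_trans; [apply Cmod_triangle|].
    rewrite Cmod_mult, Cmod_R, Cmod_cis. assert (h := coef_bounds k).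
    rewrite Rabs_pos_eq by lra. lra.
Qed.

Lemma one_sub_pow_le (r : R) (n : nat) : 0 <= r <= 1 -> 1 - r ^ n <= INR n * (1 - r).
Proof.
  intros Hr. induction n as [|n IH]; [simpl; lra|].
  rewrite S_INR. simpl (r ^ S n).
  assert (h : 0 <= r ^ n <= 1).
  { split; [apply pow_le; lra|]. rewrite <- (pow1 n). apply pow_incr. lra. }
  nra.
Qed.

Lemma inv_freq_series (k : nat) :
  ex_series (fun j => / INR (freq (k + j))) /\
  Series (fun j => / INR (freq (k + j))) <= 2 / INR (freq k).
Proof.
  replace (2 / INR (freq k)) with ((fun j => 2 / INR (freq (k + j))) 0%nat)
    by (simpl; now rewrite Nat.add_0_r).
  apply (series_telescoping_bound (fun j => / INR (freq (k + j)))
    (fun j => 2 / INR (freq (k + j)))).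
  - intros j. rewrite Nat.add_succ_r.
    assert (h := INR_freq_growth (k + j)). assert (h1 := INR_freq_ge_1 (k + j)).
    split; [left; apply Rinv_0_lt_compat; lra|].
    assert (/ INR (freq (S (k + j))) <= / INR (freq (k + j)) / 4).
    { replace (/ INR (freq (k + j)) / 4) with (/ (4 * INR (freq (k + j)))) by (field; lra).
      apply Rinv_le_contravar; lra. }
    assert (0 < / INR (freq (k + j))) by (apply Rinv_0_lt_compat; lra).
    unfold Rdiv. lra.
  - intros j. assert (h1 := INR_freq_ge_1 (k + j)).
    left. apply Rdiv_lt_0_compat; lra.
Qed.

(* The distance to the circle lies between [1 / freq (S k)] and [1 / freq k], so the terms up to
   index [k] nearly have their boundary values while the later ones are negligible. *)
Definition good_radius (k : nat) : R := 1 - / (2 * INR (S k) * INR (freq k)).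

Lemma good_radius_gap (k : nat) :
  0 < 1 - good_radius k <= / (2 * INR (S k)).
Proof.
  unfold good_radius. assert (h := INR_S_ge_1 k). assert (h1 := INR_freq_ge_1 k).
  replace (1 - (1 - / (2 * INR (S k) * INR (freq k))))
    with (/ (2 * INR (S k) * INR (freq k))) by ring.
  split; [apply Rinv_0_lt_compat; nra|]. apply Rinv_le_contravar; nra.
Qed.

Lemma good_radius_bounds (k : nat) : 0 <= good_radius k < 1.
Proof.
  assert (h := good_radius_gap k). assert (h1 := INR_S_ge_1 k).
  assert (/ (2 * INR (S k)) <= / 1) by (apply Rinv_le_contravar; lra).
  rewrite Rinv_1 in *. lra.
Qed.

(** The terms up to index [k] change by at most [n_j (1 - r)] each, in total
    [2 (1 - r) n_k = 1 / (k + 1)]. Later terms are at most [1 / (n_j (1 - r))], and the ratio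
    [4 (k+1)^2] makes their sum at most [2 / (k + 1)]. *)
Lemma lacunary_near_walk (k : nat) (t : R) :
  Cmod (lacunary (good_radius k * cis t) - walk (S k) t)%C <= 3 / INR (S k).
Proof.
  set (r := good_radius k).
  assert (Hr : 0 <= r < 1) by apply good_radius_bounds.
  assert (h := INR_S_ge_1 k). assert (h1 := INR_freq_ge_1 k).
  assert (Hin : in_disc (r * cis t)%C).
  { apply on_circle_scale_in_disc; [apply Cmod_cis|easy]. }
  set (c := fun j => (coef j * (r * cis t) ^ freq j)%C).
  set (d := fun j => (coef j * cis (INR (freq j) * t))%C).
  assert (E : (lacunary (r * cis t) - walk (S k) t)%C
     = ((Cpartial_sum c (S k) - Cpartial_sum d (S k)) + Cseries (fun j => c (S k + j)%nat))%C).
  { change (lacunary (r * cis t)) with (Cseries c).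
    rewrite (Cseries_split c (S k)) by now apply lacunary_summable.
    change (walk (S k) t) with (Cpartial_sum d (S k)). ring. }
  rewrite E. clear E.
  eapply Rle_trans; [apply Cmod_triangle|].
  replace (3 / INR (S k)) with (1 / INR (S k) + 2 / INR (S k)) by (field; lra).
  apply Rplus_le_compat.
  - rewrite Cpartial_sum_minus.
    replace (1 / INR (S k)) with (2 * (1 - r) * INR (freq k))
      by (unfold r, good_radius; field; lra).
    apply Cpartial_sum_freq_bound. intros j. unfold c, d.
    rewrite Cpow_mult_l, cis_pow, <- RtoC_pow.
    replace (coef j * ((r ^ freq j)%R * cis (INR (freq j) * t)) - coef j * cis (INR (freq j) * t))%C
      with (coef j * (- (RtoC (1 - r ^ freq j)) * cis (INR (freq j) * t)))%C
      by (rewrite RtoC_minus; ring).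
    assert (hc := coef_bounds j).
    rewrite !Cmod_mult, Cmod_opp, !Cmod_R, Cmod_cis.
    assert (hp := one_sub_pow_le r (freq j) ltac:(lra)).
    assert (hq : r ^ freq j <= 1).
    { rewrite <- (pow1 (freq j)). apply pow_incr. lra. }
    rewrite !Rabs_pos_eq by lra. nra.
  - destruct (inv_freq_series (S k)) as [Hex HS].
    assert (Hb := Cmod_Cseries_le (fun j => c (S k + j)%nat)
      (fun j => / (1 - r) * / INR (freq (S k + j)))).
    eapply Rle_trans; [apply Hb|].
    + intros j. unfold c. eapply Rle_trans; [apply lacunary_term_le|].
      rewrite Cmod_mult, Cmod_R, Cmod_cis, Rabs_pos_eq, Rmult_1_r by lra.
      set (n := freq (S k + j)).
      assert (hn := INR_freq_ge_1 (S k + j)). fold n in hn.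
      assert (hp := pow_weighted_le r n Hr).
      apply Rmult_le_reg_r with (INR n); [lra|].
      rewrite (Rmult_assoc (/ (1 - r))), Rinv_l, Rmult_1_r by lra.
      eapply Rle_trans; [|exact hp]. rewrite Rmult_comm.
      apply Rmult_le_compat_l; [lra|].
      assert (E : r ^ n = r * r ^ (n - 1)).
      { assert (hpos := freq_pos (S k + j)). fold n in hpos.
        replace n with (S (n - 1)) at 1 by lia. easy. }
      rewrite E. assert (hq : 0 <= r ^ (n - 1)) by (apply pow_le; lra). nra.
    + now apply (ex_series_scal (K := R_AbsRing) (V := R_NormedModule)).
    + rewrite Series_scal_l.
      assert (Hg : / (1 - r) = 2 * INR (S k) * INR (freq k))
        by (unfold r, good_radius; field; lra).
      rewrite Hg.
      apply Rle_trans with (2 * (2 * INR (S k) * INR (freq k) * (2 / INR (freq (S k))))).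
      * apply Rmult_le_compat_l; [lra|]. apply Rmult_le_compat_l; [nra|easy].
      * rewrite INR_freq_S. right. field. lra.
Qed.

Lemma good_radius_lim : is_lim_seq good_radius 1.
Proof.
  apply is_lim_seq_spec. intros eps.
  destruct (archimed_cor1 eps (cond_pos eps)) as [N [HN HN0]].
  exists N. intros n Hn.
  assert (h := good_radius_gap n).
  assert (/ (2 * INR (S n)) <= / INR N).
  { assert (0 < INR N) by (apply lt_0_INR; lia).
    assert (INR N <= INR n) by (apply le_INR; easy). rewrite S_INR.
    apply Rinv_le_contravar; lra. }
  rewrite Rabs_left1 by lra. lra.
Qed.

(** * The potential of the walk *)

Lemma ln_le_sub_1 (x : R) : 0 < x -> ln x <= x - 1.
Proof.
  intros Hx. assert (h := exp_ineq1_le (ln x)). rewrite exp_ln in h by easy. lra.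
Qed.

Lemma ln_le_ln_add (x y : R) : 0 < x -> 0 < y -> ln y <= ln x + (y - x) / x.
Proof.
  intros Hx Hy. assert (h := ln_le_sub_1 (y / x) ltac:(now apply Rdiv_lt_0_compat)).
  rewrite ln_div in h by easy. replace ((y - x) / x) with (y / x - 1) by (field; lra). lra.
Qed.

Definition sqnorm (z : C) : R := fst z ^ 2 + snd z ^ 2.

Lemma sqnorm_Cmod (z : C) : sqnorm z = Cmod z ^ 2.
Proof. symmetry. apply Cmod_sqr. Qed.

(** Cross terms cancel in opposite pairs. The average gain of exactly [a ^ 2] is the source of the
    negative drift of the potential. *)
Lemma sqnorm_four_sum (s om : C) (a : R) : Cmod om = 1 ->
  sqnorm (s + a * om) + sqnorm (s + a * (Ci * om)) + sqnorm (s - a * om)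
    + sqnorm (s - a * (Ci * om)) = 4 * (sqnorm s + a ^ 2).
Proof.
  intros Hom. assert (h := Cmod_sqr om). rewrite Hom in h.
  destruct s as [x y], om as [c d]. unfold sqnorm. simpl in *.
  assert (E : c ^ 2 + d ^ 2 = 1) by (simpl; lra).
  match goal with |- ?L = ?R =>
    replace L with (4 * (x ^ 2 + y ^ 2) + 4 * a ^ 2 * (c ^ 2 + d ^ 2)) by (simpl; ring) end.
  rewrite E. simpl. ring.
Qed.

(* The product equals [|s^4 - a^4 om^4|^2]: this is the (approximate) harmonicity of
   [ln |s|], exact up to [O(a^4)]. *)
Lemma sqnorm_four_product (s om : C) (a : R) : Cmod om = 1 ->
  sqnorm (s + a * om) * sqnorm (s + a * (Ci * om)) * sqnorm (s - a * om)
    * sqnorm (s - a * (Ci * om)) <= (sqnorm s ^ 2 + a ^ 4) ^ 2.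
Proof.
  intros Hom. assert (h := Cmod_sqr om). rewrite Hom in h.
  destruct s as [x y], om as [c d]. unfold sqnorm. simpl fst in *; simpl snd in *.
  set (q := x ^ 2 + y ^ 2).
  set (X := x * c + y * d). set (Y := y * c - x * d).
  assert (E : c ^ 2 + d ^ 2 = 1) by lra.
  assert (EXY : X ^ 2 + Y ^ 2 = q).
  { unfold X, Y, q. replace (x ^ 2 + y ^ 2) with ((x ^ 2 + y ^ 2) * (c ^ 2 + d ^ 2))
      by (rewrite E; ring). ring. }
  set (Q := q + a ^ 2).
  assert (E1 : (x + (a * c - 0 * d)) ^ 2 + (y + (a * d + 0 * c)) ^ 2 = Q + 2 * a * X).
  { unfold Q, X, q. replace (a ^ 2) with (a ^ 2 * (c ^ 2 + d ^ 2)) by (rewrite E; ring). ring. }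
  assert (E2 : (x + - (a * c - 0 * d)) ^ 2 + (y + - (a * d + 0 * c)) ^ 2 = Q - 2 * a * X).
  { unfold Q, X, q. replace (a ^ 2) with (a ^ 2 * (c ^ 2 + d ^ 2)) by (rewrite E; ring). ring. }
  assert (E3 : (x + (a * (0 * c - 1 * d) - 0 * (0 * d + 1 * c))) ^ 2
     + (y + (a * (0 * d + 1 * c) + 0 * (0 * c - 1 * d))) ^ 2 = Q + 2 * a * Y).
  { unfold Q, Y, q. replace (a ^ 2) with (a ^ 2 * (c ^ 2 + d ^ 2)) by (rewrite E; ring). ring. }
  assert (E4 : (x + - (a * (0 * c - 1 * d) - 0 * (0 * d + 1 * c))) ^ 2
     + (y + - (a * (0 * d + 1 * c) + 0 * (0 * c - 1 * d))) ^ 2 = Q - 2 * a * Y).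
  { unfold Q, Y, q. replace (a ^ 2) with (a ^ 2 * (c ^ 2 + d ^ 2)) by (rewrite E; ring). ring. }
  rewrite E1, E2, E3, E4.
  clearbody X Y.
  replace ((q ^ 2 + a ^ 4) ^ 2) with ((Q ^ 2 - 2 * a ^ 2 * (X ^ 2 + Y ^ 2)) ^ 2)
    by (rewrite EXY; unfold Q; ring).
  assert (0 <= (2 * a ^ 2 * (X ^ 2 - Y ^ 2)) ^ 2) by apply pow2_ge_0.
  apply Rminus_le_0.
  replace ((Q ^ 2 - 2 * a ^ 2 * (X ^ 2 + Y ^ 2)) ^ 2
    - (Q + 2 * a * X) * (Q + 2 * a * Y) * (Q - 2 * a * X) * (Q - 2 * a * Y))
    with ((2 * a ^ 2 * (X ^ 2 - Y ^ 2)) ^ 2) by ring.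
  easy.
Qed.

(** Logarithm of the product inequality, with the concavity bound
    [ln (q^2 + a^4) <= ln (q^2) + a^4 / q^2]. The condition [a < Cmod s] keeps all four points away
    from 0. *)
Lemma ln_sqnorm_four_sum (s om : C) (a : R) : Cmod om = 1 -> 0 < a -> a < Cmod s ->
  ln (sqnorm (s + a * om)) + ln (sqnorm (s + a * (Ci * om))) + ln (sqnorm (s - a * om))
    + ln (sqnorm (s - a * (Ci * om))) <= 4 * ln (sqnorm s) + 2 * (a ^ 4 / sqnorm s ^ 2).
Proof.
  intros Hom Ha Has.
  assert (Hpos : forall v, Cmod v = a -> 0 < sqnorm (s + v)).
  { intros v Hv. rewrite sqnorm_Cmod. apply pow_lt.
    assert (h := Cmod_sub_le s (s + v)%C).
    replace (s - (s + v))%C with (- v)%C in h by ring. rewrite Cmod_opp in h. lra. }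
  assert (Ha1 : Cmod (a * om)%C = a).
  { rewrite Cmod_mult, Cmod_R, Hom, Rabs_pos_eq by lra. lra. }
  assert (Ha2 : Cmod (a * (Ci * om))%C = a).
  { rewrite !Cmod_mult, Cmod_R, Cmod_Ci, Hom, Rabs_pos_eq by lra. lra. }
  assert (P1 := Hpos _ Ha1). assert (P2 := Hpos _ Ha2).
  assert (P3 := Hpos (- (a * om))%C ltac:(now rewrite Cmod_opp)).
  assert (P4 := Hpos (- (a * (Ci * om)))%C ltac:(now rewrite Cmod_opp)).
  fold (Cminus s (a * om)) in P3. fold (Cminus s (a * (Ci * om))) in P4.
  assert (H := sqnorm_four_product s om a Hom).
  set (A := sqnorm (s + a * om)) in *. set (B := sqnorm (s + a * (Ci * om))) in *.
  set (A' := sqnorm (s - a * om)) in *. set (B' := sqnorm (s - a * (Ci * om))) in *.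
  assert (Pq : 0 < sqnorm s) by (rewrite sqnorm_Cmod; apply pow_lt; lra).
  set (q := sqnorm s) in *.
  assert (Pa : 0 < a ^ 4) by (now apply pow_lt).
  assert (Pq2 : 0 < q ^ 2) by (now apply pow_lt).
  rewrite <- !ln_mult by (repeat apply Rmult_lt_0_compat; easy).
  eapply Rle_trans; [apply ln_le; [repeat apply Rmult_lt_0_compat; easy|exact H]|].
  rewrite ln_pow by lra.
  assert (h := ln_le_ln_add (q ^ 2) (q ^ 2 + a ^ 4) Pq2 ltac:(lra)).
  rewrite ln_pow in h by easy.
  replace (q ^ 2 + a ^ 4 - q ^ 2) with (a ^ 4) in h by ring.
  simpl INR in *. lra.
Qed.

Definition potential (lam : R) (s : C) : R := ln (sqnorm s) - lam * sqnorm s.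

(** Absorbs the deviation of a true step from the symmetric one. The logarithm contributes
    [4 eta / eps], and the quadratic term at most [eta / L <= eta / eps]. *)
Lemma potential_perturb (lam eps L eta : R) (x p : C) :
  0 < eps -> eps <= L -> lam = / (4 * L ^ 2) ->
  3 * eps / 4 <= Cmod x <= 2 * L -> Cmod p <= eta -> eta <= eps / 4 ->
  potential lam (x + p) <= potential lam x + 5 * eta / eps.
Proof.
  intros He HL -> Hx Hp Heta.
  assert (Pp := Cmod_ge_0 p).
  assert (T1 := Cmod_triangle x p).
  assert (T2 := Cmod_sub_le x (x + p)%C).
  replace (x - (x + p))%C with (- p)%C in T2 by ring. rewrite Cmod_opp in T2.
  unfold potential. rewrite !sqnorm_Cmod.
  set (X := Cmod x) in *. set (Y := Cmod (x + p)%C) in *. set (e := Cmod p) in *.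
  assert (HX2 : 0 < X ^ 2) by (apply pow_lt; lra).
  assert (HY2 : 0 < Y ^ 2) by (apply pow_lt; lra).
  assert (h := ln_le_ln_add (X ^ 2) (Y ^ 2) HX2 HY2).
  assert (h1 : (Y ^ 2 - X ^ 2) / X ^ 2 <= 4 * eta / eps).
  { apply Rle_div_l; [easy|].
    replace (4 * eta / eps * X ^ 2) with (X * (4 * eta * (X / eps))) by (field; lra).
    assert (3 / 4 <= X / eps) by (apply (Rle_div_r (3 / 4) X eps); lra).
    assert (Y ^ 2 - X ^ 2 <= X * (3 * eta)) by nra.
    assert (X * (3 * eta) <= X * (4 * eta * (X / eps))); [|lra].
    apply Rmult_le_compat_l; nra. }
  assert (h2 : / (4 * L ^ 2) * X ^ 2 - / (4 * L ^ 2) * Y ^ 2 <= eta / eps).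
  { rewrite <- Rmult_minus_distr_l.
    assert (HL2 : 0 < 4 * L ^ 2) by (assert (0 < L ^ 2) by (apply pow_lt; lra); lra).
    apply Rle_trans with (/ (4 * L ^ 2) * (2 * (2 * L) * eta)).
    - apply Rmult_le_compat_l; [left; now apply Rinv_0_lt_compat|]. nra.
    - replace (/ (4 * L ^ 2) * (2 * (2 * L) * eta)) with (eta * / L) by (field; lra).
      apply Rmult_le_compat_l; [lra|]. apply Rinv_le_contravar; lra. }
  unfold Rdiv in *. lra.
Qed.

Lemma potential_four_step (lam eps L eta a : R) (s om p0 p1 p2 p3 : C) :
  0 < eps -> eps <= L -> lam = / (4 * L ^ 2) ->
  eps <= Cmod s <= L -> Cmod om = 1 -> 0 < a <= eps / 4 -> eta <= eps / 4 ->
  Cmod p0 <= eta -> Cmod p1 <= eta -> Cmod p2 <= eta -> Cmod p3 <= eta ->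
  potential lam (s + a * om + p0) + potential lam (s + a * (Ci * om) + p1)
    + potential lam (s - a * om + p2) + potential lam (s - a * (Ci * om) + p3)
  <= 4 * (potential lam s + (a ^ 4 / (2 * eps ^ 4) + 5 * eta / eps) - lam * a ^ 2).
Proof.
  intros He HL Hlam Hs Hom Ha Heta H0 H1 H2 H3.
  assert (Hnear : forall v, Cmod v = a -> 3 * eps / 4 <= Cmod (s + v)%C <= 2 * L).
  { intros v Hv. assert (h := Cmod_sub_le s (s + v)%C).
    replace (s - (s + v))%C with (- v)%C in h by ring. rewrite Cmod_opp in h.
    assert (h1 := Cmod_triangle s v). lra. }
  assert (Ha1 : Cmod (a * om)%C = a).
  { rewrite Cmod_mult, Cmod_R, Hom, Rabs_pos_eq by lra. lra. }
  assert (Ha2 : Cmod (a * (Ci * om))%C = a).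
  { rewrite !Cmod_mult, Cmod_R, Cmod_Ci, Hom, Rabs_pos_eq by lra. lra. }
  assert (K0 := potential_perturb lam eps L eta _ p0 He HL Hlam (Hnear _ Ha1) H0 Heta).
  assert (K1 := potential_perturb lam eps L eta _ p1 He HL Hlam (Hnear _ Ha2) H1 Heta).
  assert (K2 := potential_perturb lam eps L eta (s - a * om) p2 He HL Hlam
    (Hnear (- (a * om))%C ltac:(now rewrite Cmod_opp)) H2 Heta).
  assert (K3 := potential_perturb lam eps L eta (s - a * (Ci * om)) p3 He HL Hlam
    (Hnear (- (a * (Ci * om)))%C ltac:(now rewrite Cmod_opp)) H3 Heta).
  assert (Kl := ln_sqnorm_four_sum s om a Hom ltac:(lra) ltac:(lra)).
  assert (Kq := sqnorm_four_sum s om a Hom).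
  assert (Kd : a ^ 4 / sqnorm s ^ 2 <= a ^ 4 / eps ^ 4).
  { apply Rmult_le_compat_l; [apply pow_le; lra|].
    apply Rinv_le_contravar; [apply pow_lt; lra|].
    rewrite sqnorm_Cmod. replace (eps ^ 4) with ((eps ^ 2) ^ 2) by ring.
    apply pow_incr. split; [apply pow_le; lra|]. apply pow_incr. lra. }
  replace (a ^ 4 / (2 * eps ^ 4)) with (a ^ 4 / eps ^ 4 / 2) by (field; lra).
  unfold potential in *. nra.
Qed.

(** * Finite covers by open intervals *)

Definition total_length (l : list (R * R)) : R :=
  fold_right (fun I s => snd I - fst I + s) 0 l.

(** Stands in for outer measure at most [x]. Finite lists suffice because the walk is observed only
    up to a finite time [K], and finite subadditivity is all that the recursion uses. *)
Definition coverable (P : R -> Prop) (x : R) : Prop :=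
  exists l : list (R * R),
    (forall I, In I l -> fst I <= snd I) /\
    (forall t, P t -> exists I, In I l /\ fst I < t < snd I) /\
    total_length l <= x.

Lemma total_length_app (l l' : list (R * R)) :
  total_length (l ++ l') = total_length l + total_length l'.
Proof. induction l as [|I l IH]; simpl; [ring|]. rewrite IH. ring. Qed.

Lemma coverable_le (P Q : R -> Prop) (x y : R) :
  (forall t, Q t -> P t) -> x <= y -> coverable P x -> coverable Q y.
Proof.
  intros HPQ Hxy [l [H1 [H2 H3]]]. exists l. repeat split; auto. lra.
Qed.

Lemma coverable_empty (P : R -> Prop) (x : R) :
  (forall t, ~ P t) -> 0 <= x -> coverable P x.
Proof.
  intros HP Hx. exists nil. repeat split; simpl; [easy| |easy].
  intros t Ht. now apply HP in Ht.
Qed.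

Lemma coverable_or (P Q : R -> Prop) (x y : R) :
  coverable P x -> coverable Q y -> coverable (fun t => P t \/ Q t) (x + y).
Proof.
  intros [l [H1 [H2 H3]]] [l' [H1' [H2' H3']]]. exists (l ++ l'). repeat split.
  - intros I HI. apply in_app_or in HI as [HI|HI]; auto.
  - intros t [Ht|Ht].
    + destruct (H2 t Ht) as [I [HI HIt]]. exists I. split; [|easy]. apply in_or_app; auto.
    + destruct (H2' t Ht) as [I [HI HIt]]. exists I. split; [|easy]. apply in_or_app; auto.
  - rewrite total_length_app. lra.
Qed.

Lemma coverable_bounded_union (P : nat -> R -> Prop) (x : R) (n : nat) :
  (forall b, (b < n)%nat -> coverable (P b) x) ->
  coverable (fun t => exists b, (b < n)%nat /\ P b t) (INR n * x).
Proof.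
  induction n as [|n IH]; intros H.
  - apply coverable_empty; [|simpl; lra]. intros t [b [Hb _]]. lia.
  - rewrite S_INR, Rmult_plus_distr_r, Rmult_1_l.
    eapply coverable_le; [|apply Rle_refl|apply coverable_or;
      [apply IH; intros b Hb; apply H; lia|apply (H n); lia]].
    intros t [b [Hb Ht]].
    destruct (Nat.eq_dec b n) as [->|Hne]; [now right|left; exists b; split; [lia|easy]].
Qed.

(** * Recurrence of the walk *)

Definition node (k m : nat) : R := 2 * PI * INR m / INR (freq k).

Definition mesh (k : nat) : R := 2 * PI / INR (freq k).

Lemma mesh_pos (k : nat) : 0 < mesh k.
Proof.
  assert (h := PI_RGT_0). assert (h1 := INR_freq_ge_1 k).
  apply Rdiv_lt_0_compat; lra.
Qed.

Lemma node_S (k m : nat) : node k (S m) = node k m + mesh k.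
Proof.
  unfold node, mesh. assert (h1 := INR_freq_ge_1 k). rewrite S_INR. field. lra.
Qed.

(** Arc [m] has [4 (k+1)^2] subarcs: [i < 4] selects a quarter of the arc and [b] a position inside
    it. Equal [b] and varying [i] give points a quarter period of [z^(n_k)] apart. *)
Definition child (k m i b : nat) : nat := ((m * 4 + i) * (S k * S k) + b)%nat.

Lemma node_child (k m i b : nat) :
  node (S k) (child k m i b) =
  node k m + mesh (S k) * (INR i * INR (S k) ^ 2 + INR b).
Proof.
  unfold node, mesh, child. rewrite INR_freq_S.
  assert (h := INR_freq_ge_1 k). assert (h1 := INR_S_ge_1 k).
  rewrite plus_INR, !mult_INR, plus_INR, mult_INR.
  replace (INR 4) with 4 by (simpl; ring). field. lra.
Qed.

Lemma mesh_S (k : nat) : mesh k = mesh (S k) * (4 * INR (S k) ^ 2).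
Proof.
  unfold mesh. rewrite INR_freq_S.
  assert (h := INR_freq_ge_1 k). assert (h1 := INR_S_ge_1 k). field. lra.
Qed.

Lemma node_child_near (k m i b : nat) : (i < 4)%nat -> (b < S k * S k)%nat ->
  0 <= node (S k) (child k m i b) - node k m <= mesh k.
Proof.
  intros Hi Hb. rewrite node_child, (mesh_S k).
  assert (hm := mesh_pos (S k)).
  assert (Hi' : INR i <= 3) by (replace 3 with (INR 3) by (simpl; ring); apply le_INR; lia).
  assert (Hb' : INR b <= INR (S k) ^ 2).
  { replace (INR (S k) ^ 2) with (INR (S k * S k)) by (rewrite mult_INR; ring).
    apply le_INR. lia. }
  assert (hi := pos_INR i). assert (hb := pos_INR b).
  set (x := INR (S k) ^ 2) in *.
  replace (node k m + mesh (S k) * (INR i * x + INR b) - node k m)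
    with (mesh (S k) * (INR i * x + INR b)) by ring.
  split; [apply Rmult_le_pos; nra|]. apply Rmult_le_compat_l; nra.
Qed.

Lemma cis_child (k m i b : nat) :
  cis (INR (freq k) * node (S k) (child k m i b)) =
  cis (INR i * (PI / 2) + PI * INR b / (2 * INR (S k) ^ 2)).
Proof.
  assert (h := INR_freq_ge_1 k). assert (h1 := INR_S_ge_1 k).
  replace (INR (freq k) * node (S k) (child k m i b))
    with (INR i * (PI / 2) + PI * INR b / (2 * INR (S k) ^ 2) + 2 * INR m * PI).
  - unfold cis. now rewrite cos_period, sin_period.
  - rewrite node_child. unfold node, mesh. rewrite INR_freq_S. field. lra.
Qed.

Lemma cis_PI2 : cis (PI / 2) = Ci.
Proof. unfold cis. now rewrite cos_PI2, sin_PI2. Qed.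

Lemma cis_quarter_turn (t : R) : cis (PI / 2 + t) = (Ci * cis t)%C.
Proof. now rewrite cis_plus, cis_PI2. Qed.

Lemma Ci_sqr : (Ci * Ci = - (1))%C.
Proof. unfold Ci, Cmult, Copp, RtoC; simpl. f_equal; ring. Qed.

Lemma walk_child (w : C) (k m b : nat) (k' : nat) :
  k = S k' -> (b < S k * S k)%nat ->
  exists (om p0 p1 p2 p3 : C),
    let s := (walk k (node k m) - w)%C in
    let s' := fun i => (walk (S k) (node (S k) (child k m i b)) - w)%C in
    Cmod om = 1 /\
    Cmod p0 <= 8 / INR k ^ 2 /\ Cmod p1 <= 8 / INR k ^ 2 /\
    Cmod p2 <= 8 / INR k ^ 2 /\ Cmod p3 <= 8 / INR k ^ 2 /\
    s' 0%nat = (s + coef k * om + p0)%C /\ s' 1%nat = (s + coef k * (Ci * om) + p1)%C /\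
    s' 2%nat = (s - coef k * om + p2)%C /\ s' 3%nat = (s - coef k * (Ci * om) + p3)%C.
Proof.
  intros Hk Hb.
  pose (p := fun i => (walk k (node (S k) (child k m i b)) - walk k (node k m))%C).
  assert (Hp : forall i, (i < 4)%nat -> Cmod (p i) <= 8 / INR k ^ 2).
  { intros i Hi. unfold p. subst k.
    eapply Rle_trans; [apply walk_lipschitz|].
    assert (hn := node_child_near (S k') m i b Hi Hb).
    rewrite Rabs_pos_eq by easy.
    assert (h := INR_freq_ge_1 k'). assert (h1 := INR_S_ge_1 k').
    apply Rle_trans with (4 * INR (freq k') * mesh (S k')).
    - apply Rmult_le_compat_l; [lra|easy].
    - unfold mesh. rewrite INR_freq_S.
      replace (4 * INR (freq k') * (2 * PI / (INR (freq k') * (4 * INR (S k') ^ 2))))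
        with (2 * PI * / INR (S k') ^ 2) by (field; lra).
      apply Rmult_le_compat_r.
      + left. apply Rinv_0_lt_compat, pow_lt. lra.
      + assert (h2 := PI_4). lra. }
  exists (cis (PI * INR b / (2 * INR (S k) ^ 2))), (p 0%nat), (p 1%nat), (p 2%nat), (p 3%nat).
  cbv zeta.
  split; [apply Cmod_cis|].
  do 4 (split; [apply Hp; lia|]).
  set (th := PI * INR b / (2 * INR (S k) ^ 2)).
  assert (E2 : forall t, cis (PI + t) = (- cis t)%C).
  { intros t. replace (PI + t) with (PI / 2 + (PI / 2 + t)) by field.
    rewrite !cis_quarter_turn, Cmult_assoc, Ci_sqr. ring. }
  repeat split; rewrite walk_S, cis_child; fold th; unfold p.
  - replace (INR 0 * (PI / 2) + th) with th by (simpl; ring). ring.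
  - replace (INR 1 * (PI / 2) + th) with (PI / 2 + th) by (simpl; ring).
    rewrite cis_quarter_turn. ring.
  - replace (INR 2 * (PI / 2) + th) with (PI + th) by (simpl; field).
    rewrite E2. ring.
  - replace (INR 3 * (PI / 2) + th) with (PI + (PI / 2 + th)) by (simpl; field).
    rewrite E2, cis_quarter_turn. ring.
Qed.

Lemma nat_floor_below (x : R) (n : nat) : 0 <= x < INR n ->
  exists d, (d < n)%nat /\ INR d <= x < INR (S d).
Proof.
  induction n as [|n IH]; intros Hx; [simpl in Hx; lra|].
  destruct (Rlt_dec x (INR n)) as [H|H].
  - destruct IH as [d [Hd Hdx]]; [lra|]. exists d. split; [lia|easy].
  - exists n. split; [lia|lra].
Qed.

Lemma interval_children (k m : nat) (t : R) :
  node k m <= t < node k (S m) ->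
  exists i b, (i < 4)%nat /\ (b < S k * S k)%nat /\
    node (S k) (child k m i b) <= t < node (S k) (S (child k m i b)).
Proof.
  intros Ht. assert (hm := mesh_pos (S k)).
  set (Q := (S k * S k)%nat).
  destruct (nat_floor_below ((t - node k m) / mesh (S k)) (4 * Q)) as [d [Hd Hdx]].
  { rewrite node_S, mesh_S in Ht. split.
    - apply Rle_div_r; lra.
    - apply Rlt_div_l; [easy|]. unfold Q. rewrite !mult_INR.
      replace (INR 4) with 4 by (simpl; ring). lra. }
  assert (HQ : Q <> 0%nat) by (unfold Q; lia).
  exists (d / Q)%nat, (d mod Q)%nat.
  split; [apply Nat.Div0.div_lt_upper_bound; lia|].
  split; [now apply Nat.mod_upper_bound|].
  rewrite node_S, node_child.
  replace (INR (S k) ^ 2) with (INR Q) by (unfold Q; rewrite mult_INR; ring).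
  assert (E : INR d = INR (d / Q) * INR Q + INR (d mod Q)).
  { rewrite <- mult_INR, <- plus_INR. f_equal.
    rewrite Nat.mul_comm. now apply Nat.div_mod. }
  rewrite <- E. rewrite S_INR in Hdx. destruct Hdx as [H1 H2].
  apply Rle_div_r in H1; [|easy]. apply Rlt_div_l in H2; [|easy]. lra.
Qed.

(** Chosen so that [drift_const eps * (1/k - 1/(k+1))] dominates the positive drift of step [k]:
    [a^4 / (2 eps^4)] with [a^4 = 1/(k+1)^2], and [5 (8 / k^2) / eps], where
    [1/k^2 <= 2 / (k (k+1))] turns 40 into 80. *)
Definition drift_const (eps : R) : R := / (2 * eps ^ 4) + 80 / eps.

(** Equals [ln (L^2) - ln ((eps/2)^2)], the logarithmic gap between distance [eps / 2] and distance
    [L]. The ratio of the majorant to it plays the role of the probability of not hitting the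
    disc. *)
Definition height (eps L : R) : R := ln (4 * L ^ 2 / eps ^ 2).

(* Supermartingale majorant: [1 - ln (eps^2/4)] makes the potential nonnegative, the third
   term is the total of the remaining positive drifts, and the last one pays for the
   number of steps still available before time [K]. *)
Definition escape_majorant (eps L : R) (K k : nat) (s : C) : R :=
  potential (/ (4 * L ^ 2)) s + (1 - ln (eps ^ 2 / 4)) + drift_const eps / INR k
  + Rmax 0 (height eps L - / (4 * L ^ 2) * (ln (INR K + 1) - ln (INR k + 1))).

(** The weight [/ (4 * L ^ 2)] is such that the quadratic term is at most 1 as long as
    [|s| <= 2 L]. *)
Lemma potential_lower (eps L r : R) (s : C) :
  0 < r -> 0 < L -> r <= Cmod s <= 2 * L ->
  ln (r ^ 2) - 1 <= potential (/ (4 * L ^ 2)) s.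
Proof.
  intros Hr HL Hs. unfold potential. rewrite sqnorm_Cmod.
  assert (h : ln (r ^ 2) <= ln (Cmod s ^ 2)).
  { apply ln_le; [now apply pow_lt|]. apply pow_incr. lra. }
  assert (HL2 : 0 < L ^ 2) by (now apply pow_lt).
  assert (/ (4 * L ^ 2) * Cmod s ^ 2 <= 1); [|lra].
  apply Rle_trans with (/ (4 * L ^ 2) * (2 * L) ^ 2).
  - apply Rmult_le_compat_l; [left; apply Rinv_0_lt_compat; lra|]. apply pow_incr. lra.
  - right. field. lra.
Qed.

Lemma height_pos (eps L : R) : 0 < eps -> eps <= L -> 0 < height eps L.
Proof.
  intros He HL. unfold height. rewrite <- ln_1. apply ln_increasing; [lra|].
  apply Rlt_div_r; [now apply pow_lt|]. nra.
Qed.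

Lemma drift_const_pos (eps : R) : 0 < eps -> 0 < drift_const eps.
Proof.
  intros He. unfold drift_const. apply Rplus_lt_0_compat.
  - apply Rinv_0_lt_compat. assert (h := pow_lt eps 4 He). lra.
  - apply Rdiv_lt_0_compat; lra.
Qed.

Lemma escape_majorant_nonneg (eps L : R) (K k : nat) (s : C) :
  0 < eps -> eps <= L -> (1 <= k)%nat -> eps / 2 <= Cmod s <= 2 * L ->
  0 <= escape_majorant eps L K k s.
Proof.
  intros He HL Hk Hs. unfold escape_majorant.
  assert (h := potential_lower eps L (eps / 2) s ltac:(lra) ltac:(lra) Hs).
  replace ((eps / 2) ^ 2) with (eps ^ 2 / 4) in h by field.
  assert (h1 := Rmax_l 0 (height eps L - / (4 * L ^ 2) * (ln (INR K + 1) - ln (INR k + 1)))).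
  assert (h2 : 0 < drift_const eps / INR k).
  { apply Rdiv_lt_0_compat; [now apply drift_const_pos|]. apply lt_0_INR. lia. }
  lra.
Qed.

Lemma escape_majorant_far (eps L : R) (K k : nat) (s : C) :
  0 < eps -> eps <= L -> (1 <= k)%nat -> L <= Cmod s <= 2 * L ->
  height eps L <= escape_majorant eps L K k s.
Proof.
  intros He HL Hk Hs. unfold escape_majorant.
  assert (h := potential_lower eps L L s ltac:(lra) ltac:(lra) Hs).
  assert (E : height eps L = ln (L ^ 2) - ln (eps ^ 2 / 4)).
  { unfold height. rewrite <- ln_div; [f_equal; field; lra|apply pow_lt; lra|].
    assert (h0 := pow_lt eps 2 He). lra. }
  assert (h1 := Rmax_l 0 (height eps L - / (4 * L ^ 2) * (ln (INR K + 1) - ln (INR k + 1)))).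
  assert (h2 : 0 < drift_const eps / INR k).
  { apply Rdiv_lt_0_compat; [now apply drift_const_pos|]. apply lt_0_INR. lia. }
  lra.
Qed.

(** At time [K] the logarithms cancel, and the [Rmax] term alone is at least [height eps L]. *)
Lemma escape_majorant_last (eps L : R) (K : nat) (s : C) :
  0 < eps -> eps <= L -> (1 <= K)%nat -> eps / 2 <= Cmod s <= 2 * L ->
  height eps L <= escape_majorant eps L K K s.
Proof.
  intros He HL Hk Hs. unfold escape_majorant.
  assert (h := potential_lower eps L (eps / 2) s ltac:(lra) ltac:(lra) Hs).
  replace ((eps / 2) ^ 2) with (eps ^ 2 / 4) in h by field.
  assert (h1 := Rmax_r 0 (height eps L - / (4 * L ^ 2) * (ln (INR K + 1) - ln (INR K + 1)))).
  assert (h2 : 0 < drift_const eps / INR K).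
  { apply Rdiv_lt_0_compat; [now apply drift_const_pos|]. apply lt_0_INR. lia. }
  lra.
Qed.

(** The positive drift is paid by the decrease of [drift_const eps / k]. The negative drift
    [- lam a^2 = - lam / (k+1)] pays for the growth of the [Rmax] term, because
    [ln (k+2) - ln (k+1) <= 1 / (k+1)]. *)
Lemma escape_majorant_four_step (eps L : R) (K k : nat) (s om p0 p1 p2 p3 : C) :
  0 < eps -> eps <= L -> (1 <= k)%nat ->
  coef k <= eps / 4 -> 8 / INR k ^ 2 <= eps / 4 ->
  eps <= Cmod s <= L -> Cmod om = 1 ->
  Cmod p0 <= 8 / INR k ^ 2 -> Cmod p1 <= 8 / INR k ^ 2 ->
  Cmod p2 <= 8 / INR k ^ 2 -> Cmod p3 <= 8 / INR k ^ 2 ->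
  escape_majorant eps L K (S k) (s + coef k * om + p0)
    + escape_majorant eps L K (S k) (s + coef k * (Ci * om) + p1)
    + escape_majorant eps L K (S k) (s - coef k * om + p2)
    + escape_majorant eps L K (S k) (s - coef k * (Ci * om) + p3)
  <= 4 * escape_majorant eps L K k s.
Proof.
  intros He HL Hk Ha Heta Hs Hom H0 H1 H2 H3.
  assert (hc := coef_bounds k).
  assert (St := potential_four_step (/ (4 * L ^ 2)) eps L (8 / INR k ^ 2) (coef k)
    s om p0 p1 p2 p3 He HL eq_refl Hs Hom ltac:(lra) Heta H0 H1 H2 H3).
  unfold escape_majorant.
  set (lam := / (4 * L ^ 2)) in *.
  assert (Hlam : 0 < lam).
  { apply Rinv_0_lt_compat. assert (h := pow_lt L 2 ltac:(lra)). lra. }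
  assert (E2 := coef_sqr k). rewrite S_INR in *.
  assert (E4 : coef k ^ 4 = (/ (INR k + 1)) ^ 2) by (rewrite <- E2; ring).
  rewrite E4, E2 in St.
  assert (Hx : 1 <= INR k) by (change 1 with (INR 1); apply le_INR; easy).
  set (x := INR k) in *.
  assert (Hi : 0 < / (x * (x + 1))) by (apply Rinv_0_lt_compat; nra).
  assert (D1 : (/ (x + 1)) ^ 2 <= / (x * (x + 1))).
  { rewrite pow_inv. apply Rinv_le_contravar; nra. }
  assert (D2 : / x ^ 2 <= 2 * / (x * (x + 1))).
  { replace (2 * / (x * (x + 1))) with (/ (x * (x + 1) / 2)) by (field; lra).
    apply Rinv_le_contravar; nra. }
  assert (D : (/ (x + 1)) ^ 2 / (2 * eps ^ 4) + 5 * (8 / x ^ 2) / eps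
     <= drift_const eps / x - drift_const eps / (x + 1)).
  { replace (drift_const eps / x - drift_const eps / (x + 1))
      with (drift_const eps * / (x * (x + 1))) by (field; lra).
    unfold drift_const. rewrite Rmult_plus_distr_r. apply Rplus_le_compat.
    - unfold Rdiv. rewrite Rmult_comm. apply Rmult_le_compat_l; [|easy].
      left. apply Rinv_0_lt_compat. assert (h := pow_lt eps 4 He). lra.
    - replace (5 * (8 / x ^ 2) / eps) with (40 / eps * / x ^ 2) by (field; lra).
      replace (80 / eps * / (x * (x + 1))) with (40 / eps * (2 * / (x * (x + 1))))
        by (field; lra).
      apply Rmult_le_compat_l; [|easy]. left. apply Rdiv_lt_0_compat; lra. }
  assert (Dl : ln (x + 1 + 1) <= ln (x + 1) + / (x + 1)).
  { assert (h := ln_le_ln_add (x + 1) (x + 1 + 1) ltac:(lra) ltac:(lra)).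
    replace ((x + 1 + 1 - (x + 1)) / (x + 1)) with (/ (x + 1)) in h by (field; lra). easy. }
  set (Y := height eps L - lam * (ln (INR K + 1) - ln (x + 1))) in *.
  set (Y' := height eps L - lam * (ln (INR K + 1) - ln (x + 1 + 1))) in *.
  assert (DY : Y' <= Y + lam * / (x + 1)).
  { unfold Y, Y'. assert (lam * ln (x + 1 + 1) <= lam * (ln (x + 1) + / (x + 1))); [|lra].
    apply Rmult_le_compat_l; lra. }
  assert (DM : Rmax 0 Y' <= Rmax 0 Y + lam * / (x + 1)).
  { assert (0 < lam * / (x + 1)) by (apply Rmult_lt_0_compat; [easy|apply Rinv_0_lt_compat; lra]).
    assert (h := Rmax_l 0 Y). assert (h' := Rmax_r 0 Y).
    apply Rmax_lub; lra. }
  lra.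
Qed.

Definition avoiding (w : C) (eps : R) (K k m : nat) (t : R) : Prop :=
  node k m <= t < node k (S m) /\
  forall i, (k <= i <= K)%nat -> 2 * eps <= Cmod (walk i t - w)%C.

(** The half-open arc is widened by half a mesh on either side to an open interval; hence the factor
    2 in all later length bounds. *)
Lemma coverable_avoiding_trivial (w : C) (eps : R) (K k m : nat) (x : R) :
  1 <= x -> coverable (avoiding w eps K k m) (2 * mesh k * x).
Proof.
  intros Hx. assert (hm := mesh_pos k).
  exists ((node k m - mesh k / 2, node k (S m) + mesh k / 2) :: nil).
  rewrite node_S. repeat split.
  - intros I [<-|[]]. simpl. lra.
  - intros t [Ht _]. eexists. split; [now left|]. simpl. rewrite node_S in Ht. lra.
  - simpl. nra.
Qed.

(** Within one arc the walk varies by at most [8 / k^2 <= eps]. This is why [avoiding] asks for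
    distance [2 * eps] while nodes are tested at distance [eps]. *)
Lemma avoiding_hit_empty (w : C) (eps : R) (K k m : nat) :
  (1 <= k <= K)%nat -> 8 / INR k ^ 2 <= eps ->
  Cmod (walk k (node k m) - w)%C < eps -> forall t, ~ avoiding w eps K k m t.
Proof.
  intros Hk Heta Hs t [Ht Hav]. specialize (Hav k ltac:(lia)).
  destruct k as [|k]; [lia|].
  assert (h := walk_lipschitz k t (node (S k) m)).
  rewrite node_S in Ht. rewrite Rabs_pos_eq in h by lra.
  assert (hk := INR_freq_ge_1 k). assert (h1 := INR_S_ge_1 k).
  assert (E : 4 * INR (freq k) * mesh (S k) <= 8 / INR (S k) ^ 2).
  { unfold mesh. rewrite INR_freq_S.
    replace (4 * INR (freq k) * (2 * PI / (INR (freq k) * (4 * INR (S k) ^ 2))))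
      with (2 * PI * / INR (S k) ^ 2) by (field; lra).
    apply Rmult_le_compat_r.
    - left. apply Rinv_0_lt_compat, pow_lt. lra.
    - assert (h2 := PI_4). lra. }
  assert (h3 := Cmod_sub_triangle (walk (S k) t) (walk (S k) (node (S k) m)) w).
  assert (4 * INR (freq k) * (t - node (S k) m) <= 4 * INR (freq k) * mesh (S k)).
  { apply Rmult_le_compat_l; lra. }
  lra.
Qed.

(** Optional stopping as an induction on the remaining time [j]. At a hit there is nothing to cover;
    at distance [L] or at time [K] the majorant is at least the height and the whole arc may be
    taken; otherwise the arc is split and the four-step inequality applied. From [eps <= |s| <= L] a
    step of length at most [eps / 2] stays in the range [eps / 2] to [2 L]. *)
Lemma avoiding_coverable (w : C) (eps L : R) (k0 K : nat) :
  0 < eps -> eps <= L -> (1 <= k0)%nat ->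
  (forall k, (k0 <= k)%nat -> coef k <= eps / 4 /\ 8 / INR k ^ 2 <= eps / 4) ->
  forall j k m, (k + j = K)%nat -> (k0 <= k)%nat ->
    eps / 2 <= Cmod (walk k (node k m) - w)%C <= 2 * L ->
    coverable (avoiding w eps K k m)
      (2 * mesh k * (escape_majorant eps L K k (walk k (node k m) - w) / height eps L)).
Proof.
  intros He HL Hk0 Hsmall. assert (Hh := height_pos eps L He HL).
  induction j as [|j IH]; intros k m Hjk Hk Hs.
  { replace K with k by lia. apply coverable_avoiding_trivial.
    apply Rle_div_r; [easy|]. rewrite Rmult_1_l. apply escape_majorant_last; auto. lia. }
  destruct (Hsmall k Hk) as [Ha Heta].
  destruct (Rlt_dec (Cmod (walk k (node k m) - w)%C) eps) as [Hlt|Hge].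
  { apply coverable_empty.
    - apply avoiding_hit_empty; [lia|lra|easy].
    - assert (hm := mesh_pos k).
      assert (hM := escape_majorant_nonneg eps L K k _ He HL ltac:(lia) Hs).
      apply Rmult_le_pos; [lra|]. apply Rmult_le_pos; [easy|].
      left. now apply Rinv_0_lt_compat. }
  destruct (Rlt_dec (Cmod (walk k (node k m) - w)%C) L) as [HltL|HgeL].
  2:{ apply coverable_avoiding_trivial. apply Rle_div_r; [easy|]. rewrite Rmult_1_l.
      apply escape_majorant_far; auto; [lia|lra]. }
  set (s := (walk k (node k m) - w)%C) in *.
  set (X := escape_majorant eps L K k s / height eps L).
  apply (coverable_le (fun t => exists b, (b < S k * S k)%nat /\
     (avoiding w eps K (S k) (child k m 0 b) t \/ (avoiding w eps K (S k) (child k m 1 b) t \/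
     (avoiding w eps K (S k) (child k m 2 b) t \/ avoiding w eps K (S k) (child k m 3 b) t))))
    _ (INR (S k * S k) * (2 * mesh (S k) * (4 * X)))).
  - intros t [Ht Hav].
    destruct (interval_children k m t Ht) as [i [b [Hi [Hb Ht']]]].
    exists b. split; [easy|].
    assert (Hc : avoiding w eps K (S k) (child k m i b) t).
    { split; [easy|]. intros i' Hi'. apply Hav. lia. }
    destruct i as [|[|[|[|i]]]]; auto. lia.
  (* There are [(k+1)^2] quadruples of subarcs, and [4 (k+1)^2 mesh (S k) = mesh k]. *)
  - right. rewrite (mesh_S k), mult_INR. ring.
  - apply coverable_bounded_union. intros b Hb.
    destruct (walk_child w k m b (k - 1) ltac:(lia) Hb)
      as [om [p0 [p1 [p2 [p3 [Hom [H0 [H1 [H2 [H3 [E0 [E1 [E2 E3]]]]]]]]]]]]].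
    fold s in E0, E1, E2, E3.
    assert (hc := coef_bounds k).
    assert (Ha1 : Cmod (coef k * om)%C = coef k).
    { rewrite Cmod_mult, Cmod_R, Hom, Rabs_pos_eq by lra. lra. }
    assert (Ha2 : Cmod (coef k * (Ci * om))%C = coef k).
    { rewrite !Cmod_mult, Cmod_R, Cmod_Ci, Hom, Rabs_pos_eq by lra. lra. }
    assert (Hnear : forall v p, Cmod v = coef k -> Cmod p <= 8 / INR k ^ 2 ->
              eps / 2 <= Cmod (s + v + p)%C <= 2 * L).
    { intros v p Hv Hp.
      assert (t1 := Cmod_triangle (s + v) p). assert (t2 := Cmod_triangle s v).
      assert (t3 := Cmod_sub_le s (s + v + p)%C).
      replace (s - (s + v + p))%C with (- v + - p)%C in t3 by ring.
      assert (t4 := Cmod_triangle (- v) (- p)). rewrite !Cmod_opp in t4. lra. }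
    assert (N0 := Hnear _ _ Ha1 H0). assert (N1 := Hnear _ _ Ha2 H1).
    assert (N2 := Hnear (- (coef k * om))%C p2 ltac:(now rewrite Cmod_opp) H2).
    assert (N3 := Hnear (- (coef k * (Ci * om)))%C p3 ltac:(now rewrite Cmod_opp) H3).
    fold (Cminus s (coef k * om)) in N2. fold (Cminus s (coef k * (Ci * om))) in N3.
    assert (St := escape_majorant_four_step eps L K k s om p0 p1 p2 p3 He HL ltac:(lia) Ha Heta
      ltac:(lra) Hom H0 H1 H2 H3).
    rewrite <- E0 in N0, St. rewrite <- E1 in N1, St.
    rewrite <- E2 in N2, St. rewrite <- E3 in N3, St.
    assert (C0 := IH (S k) (child k m 0 b) ltac:(lia) ltac:(lia) N0).
    assert (C1 := IH (S k) (child k m 1 b) ltac:(lia) ltac:(lia) N1).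
    assert (C2 := IH (S k) (child k m 2 b) ltac:(lia) ltac:(lia) N2).
    assert (C3 := IH (S k) (child k m 3 b) ltac:(lia) ltac:(lia) N3).
    eapply coverable_le; [intros t Ht; exact Ht| |
      apply (coverable_or _ _ _ _ C0 (coverable_or _ _ _ _ C1 (coverable_or _ _ _ _ C2 C3)))].
    rewrite <- !Rmult_plus_distr_l.
    assert (hm := mesh_pos (S k)).
    apply Rmult_le_compat_l; [lra|].
    unfold X, Rdiv. rewrite <- !Rmult_plus_distr_r, <- Rmult_assoc.
    apply Rmult_le_compat_r; [left; now apply Rinv_0_lt_compat|]. lra.
Qed.

Lemma exists_nat_ge (x : R) : exists n, x <= INR n.
Proof. destruct (INR_unbounded x) as [n Hn]. exists n. lra. Qed.

Lemma steps_eventually_small (eps : R) : 0 < eps ->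
  exists n, forall k, (n <= k)%nat -> coef k <= eps / 4 /\ 8 / INR k ^ 2 <= eps / 4.
Proof.
  intros He.
  destruct (exists_nat_ge (32 / eps + 16 / eps ^ 2 + 1)) as [n Hn].
  exists n. intros k Hk. apply le_INR in Hk.
  assert (h1 : 0 < 32 / eps) by (apply Rdiv_lt_0_compat; lra).
  assert (h2 : 0 < 16 / eps ^ 2) by (apply Rdiv_lt_0_compat; [lra|now apply pow_lt]).
  split.
  - assert (hc := coef_bounds k). assert (E := coef_sqr k). rewrite S_INR in E.
    assert (/ (INR k + 1) <= (eps / 4) ^ 2).
    { replace ((eps / 4) ^ 2) with (/ (16 / eps ^ 2)) by (field; lra).
      apply Rinv_le_contravar; lra. }
    apply Rnot_lt_le. intros Hlt. nra.
  - apply Rle_div_l; [apply pow_lt; lra|].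
    apply Rle_trans with (eps / 4 * (32 / eps)); [right; field; lra|].
    apply Rmult_le_compat_l; nra.
Qed.

(** The order of choices matters. First [k0], after which steps are small; the walk is then within
    [R] of [w], so the majorant at time [k0] is at most an [X] independent of [L] once its [Rmax]
    term vanishes. Next [L], making [X] small against the height. Last [K], so large that the
    divergence of [ln K] removes the [Rmax] term. *)
Lemma walk_avoidance_null (w : C) (eps delta : R) (n : nat) :
  0 < eps -> 0 < delta ->
  coverable (fun t => 0 <= t < 2 * PI /\
               forall i, (n <= i)%nat -> 2 * eps <= Cmod (walk i t - w)%C) delta.
Proof.
  intros He Hd.
  destruct (steps_eventually_small eps He) as [n1 Hn1].
  set (k0 := (n + n1 + 1)%nat).
  assert (Hsmall : forall k, (k0 <= k)%nat -> coef k <= eps / 4 /\ 8 / INR k ^ 2 <= eps / 4).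
  { intros k Hk. apply Hn1. lia. }
  set (R := INR k0 + Cmod w + 1).
  assert (HR : 1 <= R).
  { unfold R. assert (h := pos_INR k0). assert (h1 := Cmod_ge_0 w). lra. }
  assert (HsR : forall t, Cmod (walk k0 t - w)%C <= R).
  { intros t. unfold R, Cminus. eapply Rle_trans; [apply Cmod_triangle|].
    rewrite Cmod_opp. assert (h := walk_bound k0 t). lra. }
  set (X := ln (R ^ 2) + (1 - ln (eps ^ 2 / 4)) + drift_const eps / INR k0).
  (* The arcs of level [k0] have total cover length [4 PI |X| / height], and [PI <= 4]; a height of
     at least [Y] brings this below [delta]. *)
  set (Y := 16 * Rabs X / delta).
  assert (HY : 0 <= Y).
  { unfold Y. apply Rmult_le_pos; [|left; now apply Rinv_0_lt_compat].
    assert (h := Rabs_pos X). lra. }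
  set (L := Rmax R (eps * exp Y)).
  assert (HLR : R <= L) by apply Rmax_l.
  assert (HLe : eps * exp Y <= L) by apply Rmax_r.
  assert (HeY : 1 <= exp Y).
  { assert (h := exp_ineq1_le Y). lra. }
  assert (HL : eps <= L) by nra.
  assert (Hh := height_pos eps L He HL).
  assert (HhY : Y <= height eps L).
  { unfold height. rewrite <- (ln_exp Y) at 1. apply ln_le; [apply exp_pos|].
    apply Rle_div_r; [now apply pow_lt|]. nra. }
  set (lam := / (4 * L ^ 2)).
  assert (Hlam : 0 < lam).
  { apply Rinv_0_lt_compat. assert (h := pow_lt L 2 ltac:(lra)). lra. }
  set (Z := height eps L / lam + ln (INR k0 + 1)).
  destruct (exists_nat_ge (exp Z)) as [K1 HK1].
  set (K := (K1 + k0)%nat).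
  assert (HK : Z <= ln (INR K + 1)).
  { rewrite <- (ln_exp Z). apply ln_le; [apply exp_pos|].
    unfold K. rewrite plus_INR. assert (h := pos_INR k0). lra. }
  assert (Hmaj : forall s, eps / 2 <= Cmod s <= R -> escape_majorant eps L K k0 s <= X).
  { intros s Hs. unfold escape_majorant, X. fold lam.
    rewrite Rmax_left.
    2:{ unfold Z in HK. assert (h : height eps L = lam * (height eps L / lam)) by (field; lra).
        rewrite h. rewrite <- Rmult_minus_distr_l.
        apply Rmult_le_reg_l with (/ lam); [now apply Rinv_0_lt_compat|].
        rewrite <- Rmult_assoc, Rinv_l, Rmult_1_l, Rmult_0_r by lra. lra. }
    unfold potential. rewrite sqnorm_Cmod.
    assert (ln (Cmod s ^ 2) <= ln (R ^ 2)).
    { apply ln_le; [apply pow_lt; lra|]. apply pow_incr. lra. }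
    assert (0 <= lam * Cmod s ^ 2).
    { apply Rmult_le_pos; [lra|]. apply pow_le. lra. }
    lra. }
  assert (hm := mesh_pos k0).
  assert (Hpiece : forall m, (m < freq k0)%nat ->
    coverable (avoiding w eps K k0 m) (2 * mesh k0 * (Rabs X / height eps L))).
  { intros m _.
    assert (P : 0 <= Rabs X / height eps L).
    { apply Rmult_le_pos; [apply Rabs_pos|left; now apply Rinv_0_lt_compat]. }
    destruct (Rlt_dec (Cmod (walk k0 (node k0 m) - w)%C) eps) as [Hlt|Hge].
    - apply coverable_empty; [|apply Rmult_le_pos; lra].
      apply avoiding_hit_empty; [unfold K; lia| |easy].
      destruct (Hsmall k0 (Nat.le_refl _)). lra.
    - specialize (HsR (node k0 m)).
      eapply coverable_le; [intros t Ht; exact Ht| |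
        apply (avoiding_coverable w eps L k0 K He HL ltac:(lia) Hsmall K1 k0 m);
        [unfold K; lia|lia|lra]].
      apply Rmult_le_compat_l; [lra|].
      apply Rmult_le_compat_r; [left; now apply Rinv_0_lt_compat|].
      eapply Rle_trans; [apply Hmaj; lra|]. apply Rle_abs. }
  eapply coverable_le; [| |exact (coverable_bounded_union _ _ _ Hpiece)].
  - intros t [Ht Hav].
    destruct (nat_floor_below (t / mesh k0) (freq k0)) as [m [Hm [H1 H2]]].
    { assert (h1 := INR_freq_ge_1 k0). split.
      - apply Rmult_le_pos; [lra|left; now apply Rinv_0_lt_compat].
      - apply Rlt_div_l; [easy|]. unfold mesh.
        replace (INR (freq k0) * (2 * PI / INR (freq k0))) with (2 * PI) by (field; lra). lra. }
    exists m. split; [easy|].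
    assert (En : forall j, node k0 j = INR j * mesh k0).
    { intros j. unfold node, mesh. assert (h1 := INR_freq_ge_1 k0). field. lra. }
    apply Rle_div_r in H1; [|easy]. apply Rlt_div_l in H2; [|easy].
    split; [rewrite !En; lra|]. intros i Hi. apply Hav. lia.
  - assert (h1 := INR_freq_ge_1 k0).
    replace (INR (freq k0) * (2 * mesh k0 * (Rabs X / height eps L)))
      with (4 * PI * Rabs X / height eps L) by (unfold mesh; field; lra).
    apply Rle_div_l; [easy|].
    assert (hX := Rabs_pos X). assert (h2 := PI_4).
    apply Rle_trans with (delta * Y).
    + unfold Y. replace (delta * (16 * Rabs X / delta)) with (16 * Rabs X) by (field; lra). nra.
    + apply Rmult_le_compat_l; lra.
Qed.

(** * Countable unions of covers, and the exceptional directions *)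

Fixpoint concat_upto (l : nat -> list (R * R)) (n : nat) : list (R * R) :=
  match n with
  | O => nil
  | S j => concat_upto l j ++ l j
  end.

Lemma length_concat_upto (l : nat -> list (R * R)) (n : nat) :
  (forall j, l j <> nil) -> (n <= length (concat_upto l n))%nat.
Proof.
  intros Hl. induction n as [|n IH]; simpl; [lia|]. rewrite length_app.
  specialize (Hl n). destruct (l n); [easy|]. simpl. lia.
Qed.

Lemma nth_concat_upto (l : nat -> list (R * R)) (d : R * R) (i n m : nat) :
  (i < length (concat_upto l n))%nat -> (n <= m)%nat ->
  nth i (concat_upto l m) d = nth i (concat_upto l n) d.
Proof.
  intros Hi Hnm. induction Hnm as [|m Hnm IH]; [easy|]. simpl.
  rewrite app_nth1; [easy|].
  assert (h : (length (concat_upto l n) <= length (concat_upto l m))%nat); [|lia].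
  clear IH. induction Hnm as [|m Hnm IH]; [easy|]. simpl. rewrite length_app. lia.
Qed.

(** Indices past the end read the default [(0, 0)], which contributes length zero. *)
Lemma sum_nth_le_total_length (l : list (R * R)) (N : nat) :
  (forall I, In I l -> fst I <= snd I) ->
  sum_f_R0 (fun i => snd (nth i l (0, 0)) - fst (nth i l (0, 0))) N <= total_length l.
Proof.
  revert N. induction l as [|I l IH]; intros N Hl.
  - simpl. right. induction N as [|N IHN]; simpl; [ring|]. rewrite IHN. ring.
  - assert (Ht : 0 <= total_length l).
    { assert (Hl' : forall I, In I l -> fst I <= snd I) by (intros; apply Hl; now right).
      clear -Hl'. induction l as [|I l IH]; simpl; [lra|].
      assert (h := Hl' I (or_introl eq_refl)).
      specialize (IH (fun J HJ => Hl' J (or_intror HJ))). lra. }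
    destruct N as [|N]; [simpl; lra|].
    rewrite decomp_sum by lia. simpl.
    specialize (IH N (fun J HJ => Hl J (or_intror HJ))). lra.
Qed.

Lemma coverable_countable_union (P : nat -> R -> Prop) (eps : R) :
  (forall n delta, 0 < delta -> coverable (P n) delta) -> 0 < eps ->
  exists a b : nat -> R,
    (forall n, a n <= b n) /\
    (forall t, (exists n, P n t) -> exists n, a n < t < b n) /\
    (forall N, sum_f_R0 (fun n => b n - a n) N <= eps).
Proof.
  intros HP He.
  destruct (functional_choice (fun n l => l <> nil /\
    (forall I, In I l -> fst I <= snd I) /\
    (forall t, P n t -> exists I, In I l /\ fst I < t < snd I) /\
    total_length l <= eps / 2 ^ S n)) as [l Hl].
  { intros n. destruct (HP n (eps / 2 ^ S n)) as [l [H1 [H2 H3]]].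
    { apply Rdiv_lt_0_compat; [easy|]. apply pow_lt. lra. }
    (* A degenerate interval of length zero makes every list nonempty, so that the first [n] lists
       together have at least [n] entries. *)
    exists ((0, 0) :: l). repeat split.
    - easy.
    - intros I [<-|HI]; [simpl; lra|auto].
    - intros t Ht. destruct (H2 t Ht) as [I [HI HIt]]. exists I. split; [now right|easy].
    - simpl in *. lra. }
  assert (Hne : forall j, l j <> nil) by apply Hl.
  set (c := concat_upto l).
  assert (Hle : forall n I, In I (c n) -> fst I <= snd I).
  { induction n as [|n IH]; simpl; [easy|]. intros I HI.
    apply in_app_or in HI as [HI|HI]; [auto|]. now apply (Hl n). }
  assert (Htot : forall n, total_length (c n) <= eps - eps / 2 ^ n).
  { induction n as [|n IH]; [simpl; lra|].
    change (c (S n)) with (c n ++ l n). rewrite total_length_app.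
    destruct (Hl n) as [_ [_ [_ h]]].
    assert (E : eps / 2 ^ n = 2 * (eps / 2 ^ S n)).
    { simpl. field. apply pow_nonzero. lra. }
    lra. }
  (* Entry [i] already exists in [c (S i)] and is unchanged in longer concatenations, so the default
     is never read and [e] enumerates all intervals. *)
  set (e := fun i => nth i (c (S i)) (0, 0)).
  assert (Hlen : forall n, (n <= length (c n))%nat) by (intros; now apply length_concat_upto).
  exists (fun i => fst (e i)), (fun i => snd (e i)). repeat split.
  - intros n. apply (Hle (S n)). apply nth_In. specialize (Hlen (S n)). lia.
  - intros t [n Ht]. destruct (Hl n) as [_ [_ [h _]]].
    destruct (h t Ht) as [I [HI HIt]].
    assert (HIc : In I (c (S n))) by (simpl; apply in_or_app; now right).
    destruct (In_nth _ _ (0, 0) HIc) as [i [Hi Ei]].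
    exists i. replace (e i) with I; [easy|]. rewrite <- Ei. unfold e.
    transitivity (nth i (c (S n + S i)%nat) (0, 0)).
    + symmetry. apply nth_concat_upto; [exact Hi|lia].
    + apply nth_concat_upto; [|lia]. specialize (Hlen (S i)). unfold c in Hlen. lia.
  - intros N. apply Rle_trans with (total_length (c (S N))).
    + eapply Rle_trans; [|apply (sum_nth_le_total_length (c (S N)) N), Hle].
      right. apply sum_eq. intros i Hi.
      assert (E : nth i (c (S N)) (0, 0) = e i).
      { apply nth_concat_upto; [|lia]. specialize (Hlen (S i)). unfold c in Hlen. lia. }
      now rewrite E.
    + specialize (Htot (S N)).
      assert (0 < eps / 2 ^ S N) by (apply Rdiv_lt_0_compat; [easy|apply pow_lt; lra]).
      lra.
Qed.

Definition grid_point (c x y : nat) : C :=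
  (INR x / INR (S c) - INR c, INR y / INR (S c) - INR c).

(* [n] codes the mesh [1/(c+1)] and a point of the corresponding grid in [[-c, oo)^2]. *)
Definition missed_target (n : nat) (t : R) : Prop :=
  let (c, m) := Cantor.of_nat n in
  let (x, y) := Cantor.of_nat m in
  0 <= t < 2 * PI /\
  forall i, (c <= i)%nat -> 2 * / INR (S c) <= Cmod (walk i t - grid_point c x y)%C.

Lemma missed_target_null (n : nat) (delta : R) :
  0 < delta -> coverable (missed_target n) delta.
Proof.
  intros Hd. unfold missed_target.
  destruct (Cantor.of_nat n) as [c m]. destruct (Cantor.of_nat m) as [x y].
  apply walk_avoidance_null; [|easy]. apply Rinv_0_lt_compat, lt_0_INR. lia.
Qed.

Lemma grid_coordinate (c : nat) (u : R) : Rabs u <= INR c ->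
  exists x, Rabs (INR x / INR (S c) - INR c - u) <= / INR (S c).
Proof.
  intros Hu. apply Rabs_le_between in Hu. assert (h := INR_S_ge_1 c).
  destruct (exists_nat_ge ((u + INR c) * INR (S c) + 1)) as [n Hn].
  destruct (nat_floor_below ((u + INR c) * INR (S c)) n) as [x [_ [H1 H2]]].
  { split; [nra|lra]. }
  exists x. rewrite (S_INR x) in H2.
  replace (INR x / INR (S c) - INR c - u)
    with ((INR x - (u + INR c) * INR (S c)) * / INR (S c)) by (field; lra).
  rewrite Rabs_mult, (Rabs_pos_eq (/ INR (S c))) by (left; apply Rinv_0_lt_compat; lra).
  rewrite <- (Rmult_1_l (/ INR (S c))) at 2.
  apply Rmult_le_compat_r; [left; apply Rinv_0_lt_compat; lra|].
  apply Rabs_le_between. lra.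
Qed.

(** The 7 is [3 + 2 + 2]: from the function to the walk, from the walk to the grid point that it
    hits, and from the grid point to [a]. The target is taken at level [S c], so the hitting time is
    positive and has the form [S j] with [c <= j]. *)
Lemma lacunary_hits (t : R) (a : C) (c : nat) :
  0 <= t < 2 * PI -> (forall n, ~ missed_target n t) ->
  Rabs (fst a) <= INR (S c) -> Rabs (snd a) <= INR (S c) ->
  exists j, (c <= j)%nat /\
    Cmod (lacunary (good_radius j * cis t) - a)%C <= 7 / INR (S c).
Proof.
  intros Ht Hno Ha1 Ha2.
  destruct (grid_coordinate (S c) _ Ha1) as [x Hx].
  destruct (grid_coordinate (S c) _ Ha2) as [y Hy].
  specialize (Hno (Cantor.to_nat (S c, Cantor.to_nat (x, y)))).
  unfold missed_target in Hno. rewrite !Cantor.cancel_of_to in Hno.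
  assert (Hi : exists i, (S c <= i)%nat /\
             Cmod (walk i t - grid_point (S c) x y)%C < 2 * / INR (S (S c))).
  { apply NNPP. intros Hn. apply Hno. split; [easy|]. intros i Hi.
    apply Rnot_lt_le. intros Hlt. apply Hn. now exists i. }
  destruct Hi as [[|j] [Hj Hw]]; [lia|].
  exists j. split; [lia|].
  assert (Hg : Cmod (grid_point (S c) x y - a)%C <= 2 * / INR (S (S c))).
  { eapply Rle_trans; [apply Cmod_le_abs_sum|].
    change (Rabs (INR x / INR (S (S c)) - INR (S c) - fst a)
            + Rabs (INR y / INR (S (S c)) - INR (S c) - snd a) <= 2 * / INR (S (S c))).
    lra. }
  assert (T1 := lacunary_near_walk j t).
  assert (T2 := Cmod_sub_triangle (lacunary (good_radius j * cis t)) (walk (S j) t) a).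
  assert (T3 := Cmod_sub_triangle (walk (S j) t) (grid_point (S c) x y) a).
  assert (h := INR_S_ge_1 c).
  assert (I1 : / INR (S (S c)) <= / INR (S c)).
  { apply Rinv_le_contravar; [lra|]. apply le_INR. lia. }
  assert (I2 : / INR (S j) <= / INR (S c)).
  { apply Rinv_le_contravar; [lra|]. apply le_INR. lia. }
  unfold Rdiv in *. lra.
Qed.

Lemma good_radius_subseq_lim (phi : nat -> nat) :
  (forall n, (n <= phi n)%nat) -> is_lim_seq (fun n => good_radius (phi n)) 1.
Proof.
  intros Hphi. apply is_lim_seq_subseq; [|apply good_radius_lim].
  intros P [N HN]. exists N. intros n Hn. apply HN. specialize (Hphi n). lia.
Qed.

Lemma lacunary_maximal (t : R) :
  0 <= t < 2 * PI -> (forall n, ~ missed_target n t) ->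
  maximal_radial_cluster lacunary (cis t).
Proof.
  intros Ht Hno [a|].
  - destruct (exists_nat_ge (Cmod a)) as [N HN].
    assert (Hex : forall n, exists j, (n <= j)%nat /\
      Cmod (lacunary (good_radius j * cis t) - a)%C <= 7 / INR (S n)).
    { intros n.
      assert (hN : INR N <= INR (S (n + N))) by (apply le_INR; lia).
      (* The shift by [N >= |a|] places [a] inside the square covered by the grid. *)
      destruct (lacunary_hits t a (n + N) Ht Hno) as [j [Hj Hja]].
      - assert (h := re_le_Cmod a). unfold Re in h. lra.
      - assert (h := im_le_Cmod a). lra.
      - exists j. split; [lia|]. eapply Rle_trans; [exact Hja|].
        apply Rmult_le_compat_l; [lra|]. apply Rinv_le_contravar; [apply lt_0_INR; lia|].
        apply le_INR. lia. }
    destruct (functional_choice _ Hex) as [phi Hphi].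
    exists (fun n => good_radius (phi n)).
    split; [intros n; apply good_radius_bounds|].
    split; [apply good_radius_subseq_lim; intros n; apply Hphi|].
    apply filterlim_locally. intros eps.
    destruct (exists_nat_ge (7 / eps)) as [M HM].
    exists M. intros n Hn. destruct (Hphi n) as [_ H].
    set (y := lacunary (good_radius (phi n) * cis t)) in *.
    assert (Hy : Cmod (y - a)%C < eps).
    { eapply Rle_lt_trans; [exact H|]. apply Rlt_div_l; [apply lt_0_INR; lia|].
      assert (he := cond_pos eps). apply Rle_div_l in HM; [|easy].
      apply le_INR in Hn. rewrite S_INR. nra. }
    split.
    + change (Rabs (fst (y - a)%C) < eps).
      eapply Rle_lt_trans; [apply re_le_Cmod|easy].
    + change (Rabs (snd (y - a)%C) < eps).
      eapply Rle_lt_trans; [apply im_le_Cmod|easy].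
  (* For infinity the moving targets [n] are hit with error at most 7, so the modulus is at least
     [n - 7]. *)
  - assert (Hex : forall n, exists j, (n <= j)%nat /\
      Cmod (lacunary (good_radius j * cis t) - RtoC (INR n))%C <= 7).
    { intros n.
      destruct (lacunary_hits t (RtoC (INR n)) n Ht Hno) as [j [Hj Hja]].
      - simpl fst. rewrite Rabs_pos_eq by apply pos_INR. apply le_INR. lia.
      - simpl snd. rewrite Rabs_R0. apply pos_INR.
      - exists j. split; [easy|]. eapply Rle_trans; [exact Hja|].
        assert (h := INR_S_ge_1 n). apply Rle_div_l; lra. }
    destruct (functional_choice _ Hex) as [phi Hphi].
    exists (fun n => good_radius (phi n)).
    split; [intros n; apply good_radius_bounds|].
    split; [apply good_radius_subseq_lim; intros n; apply Hphi|].
    apply is_lim_seq_spec. intros M.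
    destruct (exists_nat_ge (M + 8)) as [N HN].
    exists N. intros n Hn. destruct (Hphi n) as [_ H].
    assert (h := Cmod_sub_le (RtoC (INR n)) (lacunary (good_radius (phi n) * cis t))).
    rewrite Cmod_R, Rabs_pos_eq, Cmod_sub_sym in h by apply pos_INR.
    apply le_INR in Hn. lra.
Qed.

Theorem theorem5p6 :
  (~ exists f : C -> C, U_R f /\ bloch f) /\
  (exists E : C -> Prop,
     (forall z, E z -> on_circle z) /\ arc_null E /\
     exists f : C -> C,
       U_R_K (fun z => on_circle z /\ ~ E z) f /\ bloch f).
Proof.
  split.
  - intros [f [HU HB]]. exact (no_bloch_universal f HU HB).
  (* Taking [E] to be exactly the set of bad directions makes maximality off [E] immediate; only the
     nullity of [E] remains, and it follows from the covers of the missed targets. *)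
  - exists (fun z => on_circle z /\ ~ maximal_radial_cluster lacunary z).
    split; [now intros z [Hz _]|]. split.
    + intros eps Heps.
      destruct (coverable_countable_union missed_target eps missed_target_null Heps)
        as [a [b [Hab [Hcov Hsum]]]].
      exists a, b. repeat split; auto.
      intros t Ht [_ Hnot]. apply Hcov. apply NNPP. intros Hn.
      apply Hnot. apply (lacunary_maximal t Ht).
      intros n Hmiss. apply Hn. now exists n.
    + exists lacunary. split; [split|].
      * apply lacunary_bloch.
      * intros zeta Hz [_ HE]. apply NNPP. intros Hn. now apply HE.
      * apply lacunary_bloch.
Qed.
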